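(* There is a deterministic algorithm that, given a directed graph $G$ (with a set $V^\infty(G)$ of undeletable vertices), a set $T\subseteq V(G)$ and an integer $k$, produces in time $O^*(2^{O(k^2)})$ subsets $Z_1,\dots,Z_t$ of $V(G)\setminus T$ with $t=2^{O(k^2)}\log|V(G)|$ such that the following holds. Let $W$ be a thin set with $|W|\le k$, and let $Y$ be a set of vertices such that for every $v\in Y$ there is an important $v-T$ separator $W'\subseteq W$. For every such pair $(W,Y)$ there is at least one $i\in[t]$ with $W\cap Z_i=\emptyset$ and $Y\subseteq Z_i$.
   Context: $O^*(\cdot)$ hides polynomial factors in the input size. $G$ has a (possibly empty) set $V^\infty(G)$ of undeletable vertices. For disjoint nonempty $A,B\subseteq V(G)$, a set $W\subseteq V(G)\setminus(A\cup B\cup V^\infty(G))$ is an $A-B$ separator if $G\setminus W$ has no path from $A$ to $B$; it is minimal if no proper subset is an $A-B$ separator. We write $v-T$ for $\{v\}-T$. For a digraph $H$ and $A\subseteq V(H)$, $R^+_H(A)$ is the set of vertices reachable from $A$ in $H$. A minimal $A-B$ separator $W$ is an important $A-B$ separator if there is no $A-B$ separator $W'$ with $|W'|\le|W|$ and $R^+_{G\setminus W}(A)\subsetneq R^+_{G\setminus W'}(A)$. The reverse shadow of a set $W\subseteq V(G)\setminus V^\infty(G)$ (with respect to $T$) is the set of vertices $v$ such that $W$ is a $v-T$ separator. A set $W$ is thin if no $v\in W$ belongs to the reverse shadow of $W\setminus\{v\}$ with respect to $T$.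
   Formalization: W is required to avoid T and the undeletable vertices (otherwise W is vacuously thin and the claim fails, e.g. path v→w→t, T={t}, W={t,v,w}, Y={v}), and log|V(G)| is read as 1 when |V(G)| ≤ 1, where it would force t = 0. *)

(* Defs.v *)
From mathcomp Require Import all_boot.

Set Implicit Arguments.
Unset Strict Implicit.
Unset Printing Implicit Defensive.

Record digraph := Digraph {
  nb_vertices : nat;
  edge : rel 'I_nb_vertices;
  undeletable : {set 'I_nb_vertices}
}.

Notation vertex G := 'I_(nb_vertices G).

Section Separators.
Variable G : digraph.
Implicit Types A B T W : {set vertex G}.

(* The edges of G \ W.  Vertices of W remain in the carrier, as isolated
   points; [reach] discards them. *)
Definition edge_minus W : rel (vertex G) :=
  [rel u v | [&& edge u v, u \notin W & v \notin W]].

Definition reach W A : {set vertex G} :=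
  [set v | [exists u in A, (u \notin W) && connect (edge_minus W) u v]].

Definition separator A B W : bool :=
  [&& A != set0, B != set0, [disjoint A & B],
      W \subset ~: (A :|: B :|: undeletable G) &
      [forall a in A, forall b in B, ~~ connect (edge_minus W) a b]].

Definition minimal_separator A B W : Prop :=
  separator A B W /\ forall W', W' \proper W -> ~~ separator A B W'.

Definition important_separator A B W : Prop :=
  minimal_separator A B W /\
  ~ exists W', [/\ separator A B W', #|W'| <= #|W|
                 & reach W A \proper reach W' A].

Definition reverse_shadow T W : {set vertex G} :=
  [set v | separator [set v] T W].

Definition thin T W : Prop :=
  forall v, v \in W -> v \notin reverse_shadow T (W :\ v).

End Separators.

(* The model of computation for algorithms:
   first-order recursive programs on numbers and pairs, call by value, where
   every evaluation step costs one unit.  Addition and truncated subtraction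
   are the only arithmetic, so after s steps numbers have at most s more bits
   than the input and the program constants; hence the model is polynomially
   equivalent to Turing machines. *)

Inductive data := VNat of nat | VPair of data & data.

(* [EVar i] is a de Bruijn index.  [ECall f e] runs the f-th function of the
   program on the value of e, in an environment holding only that value. *)
Inductive expr :=
  | EVar of nat
  | EConst of nat
  | EAdd of expr & expr
  | ESub of expr & expr
  | EMkPair of expr & expr
  | EFst of expr
  | ESnd of expr
  | EIsPair of expr
  | EIf of expr & expr & expr
  | ELet of expr & expr
  | ECall of nat & expr.

Definition program := seq expr.

Definition is_pair (v : data) : bool := if v is VPair _ _ then true else false.

(* [eval P env e v t]: in environment env, e evaluates to v in t steps. *)
Inductive eval (P : program) : seq data -> expr -> data -> nat -> Prop :=
  | EvVar env i : eval P env (EVar i) (nth (VNat 0) env i) 1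
  | EvConst env n : eval P env (EConst n) (VNat n) 1
  | EvAdd env e1 e2 a b t1 t2 :
      eval P env e1 (VNat a) t1 -> eval P env e2 (VNat b) t2 ->
      eval P env (EAdd e1 e2) (VNat (a + b)) (t1 + t2).+1
  | EvSub env e1 e2 a b t1 t2 :
      eval P env e1 (VNat a) t1 -> eval P env e2 (VNat b) t2 ->
      eval P env (ESub e1 e2) (VNat (a - b)) (t1 + t2).+1
  | EvMkPair env e1 e2 v w t1 t2 :
      eval P env e1 v t1 -> eval P env e2 w t2 ->
      eval P env (EMkPair e1 e2) (VPair v w) (t1 + t2).+1
  | EvFst env e v w t :
      eval P env e (VPair v w) t -> eval P env (EFst e) v t.+1
  | EvSnd env e v w t :
      eval P env e (VPair v w) t -> eval P env (ESnd e) w t.+1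
  | EvIsPair env e v t :
      eval P env e v t -> eval P env (EIsPair e) (VNat (is_pair v)) t.+1
  | EvIf env e e1 e2 n v t1 t2 :
      eval P env e (VNat n) t1 ->
      eval P env (if n == 0 then e2 else e1) v t2 ->
      eval P env (EIf e e1 e2) v (t1 + t2).+1
  | EvLet env e1 e2 v w t1 t2 :
      eval P env e1 v t1 -> eval P (v :: env) e2 w t2 ->
      eval P env (ELet e1 e2) w (t1 + t2).+1
  | EvCall env f e v w t1 t2 :
      eval P env e v t1 -> eval P [:: v] (nth (EConst 0) P f) w t2 ->
      eval P env (ECall f e) w (t1 + t2).+1.

(* The entry point of a program is its function number 0. *)
Definition runs (P : program) (input output : data) (time : nat) : Prop :=
  eval P [:: input] (nth (EConst 0) P 0) output time.

Lemma eval_det P env e v t v' t' :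
  eval P env e v t -> eval P env e v' t' -> v = v' /\ t = t'.
Proof.
move=> ev; elim: ev v' t' => {env e v t}.
- by move=> env i v' t' ev; inversion ev.
- by move=> env n v' t' ev; inversion ev.
- move=> env e1 e2 a b t1 t2 _ IH1 _ IH2 v' t' ev; inversion ev; subst.
  case: (IH1 _ _ ltac:(eassumption)) => -[->] ->.
  by case: (IH2 _ _ ltac:(eassumption)) => -[->] ->.
- move=> env e1 e2 a b t1 t2 _ IH1 _ IH2 v' t' ev; inversion ev; subst.
  case: (IH1 _ _ ltac:(eassumption)) => -[->] ->.
  by case: (IH2 _ _ ltac:(eassumption)) => -[->] ->.
- move=> env e1 e2 v w t1 t2 _ IH1 _ IH2 v' t' ev; inversion ev; subst.
  case: (IH1 _ _ ltac:(eassumption)) => -> ->.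
  by case: (IH2 _ _ ltac:(eassumption)) => -> ->.
- move=> env e v w t _ IH v' t' ev; inversion ev; subst.
  by case: (IH _ _ ltac:(eassumption)) => -[-> _] ->.
- move=> env e v w t _ IH v' t' ev; inversion ev; subst.
  by case: (IH _ _ ltac:(eassumption)) => -[_ ->] ->.
- move=> env e v t _ IH v' t' ev; inversion ev; subst.
  by case: (IH _ _ ltac:(eassumption)) => -> ->.
- move=> env e e1 e2 n v t1 t2 _ IH1 _ IH2 v' t' ev; inversion ev; subst.
  case: (IH1 _ _ ltac:(eassumption)) => -[En] ->; subst.
  by case: (IH2 _ _ ltac:(eassumption)) => -> ->.
- move=> env e1 e2 v w t1 t2 _ IH1 _ IH2 v' t' ev; inversion ev; subst.
  case: (IH1 _ _ ltac:(eassumption)) => Ev ->; subst.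
  by case: (IH2 _ _ ltac:(eassumption)) => -> ->.
move=> env f e v w t1 t2 _ IH1 _ IH2 v' t' ev; inversion ev; subst.
case: (IH1 _ _ ltac:(eassumption)) => Ev ->; subst.
by case: (IH2 _ _ ltac:(eassumption)) => -> ->.
Qed.

Definition enc_seq (s : seq data) : data := foldr VPair (VNat 0) s.

Definition enc_set n (A : {set 'I_n}) : data :=
  enc_seq [seq VNat (nat_of_ord i) | i <- enum A].

(* |V(G)|, the out-neighbour list of each vertex, the undeletable vertices,
   T, and k. *)
Definition enc_input (G : digraph) (T : {set vertex G}) (k : nat) : data :=
  VPair (VNat (nb_vertices G))
    (VPair (enc_seq [seq enc_set [set v | edge u v] | u <- enum (vertex G)])
       (VPair (enc_set (undeletable G)) (VPair (enc_set T) (VNat k)))).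

Definition enc_output n (Z : seq {set 'I_n}) : data :=
  enc_seq [seq enc_set A | A <- Z].

(* Numbers are measured in binary. *)
Fixpoint data_size (v : data) : nat :=
  match v with
  | VNat n => (trunc_log 2 n).+1
  | VPair a b => (data_size a + data_size b).+1
  end.

Definition bigO (f g : nat -> nat) : Prop :=
  exists c k0, forall k, k0 <= k -> f k <= c * g k.

(* The binary logarithm, rounded down, except that log 0 and log 1 are taken
   to be 1: with value 0 the bound would allow no set at all in a graph on at
   most one vertex. *)
Definition log2 (n : nat) : nat := maxn 1 (trunc_log 2 n).

(* Main.v *)
Require Import Defs.
From mathcomp Require Import all_boot.
From mathcomp Require Import zify.

(** For a vertex v, branching on the furthest minimum v-T cut (the measure
    2k - lambda decreases in both branches) lists at most 2^(2k+1) sets L(v):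
    all of them are v-T separators, and every important v-T separator of size
    at most k occurs.  For a set P of vertices put
    Z(P) = { v notin T : some D in L(v) is contained in P }.
    If W is contained in P then Y is contained in Z(P).  If w is in W, thinness
    says that no D in L(w) is contained in W, so W and Z(P) are disjoint as soon
    as P misses one vertex of D \ W for each of the at most k 2^(2k+1) such
    pairs (w, D).

    To find such a P, colour the vertices by functions h into q = 2^(4k+3)
    colours and let P be the set of vertices whose colour lies in a k-tuple of
    colours; it suffices that some h of the family gives no vertex of W the
    colour of a vertex to be missed.  The family is built greedily: the weight
    of a pair of vertices doubles at each collision, and giving each vertex in
    turn its cheapest colour multiplies the total weight by at most 1 + 1/q, so
    that after O(2^(4k) log n) functions each pair collides too rarely for all
    functions to be bad.

    Cuts are computed in the vertex-splitting network (u is split into u and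
    n + u) stored as a multiset of arcs, undeletable arcs being repeated k + 1
    times; reversing the arcs of a path lowers every cut by exactly one, hence
    no separate notion of flow is needed. *)

Set Implicit Arguments.
Unset Strict Implicit.
Unset Printing Implicit Defensive.

(** * Cuts and augmenting paths *)

(** The lists must contain nothing but separators: for w in W, thinness is contradicted by any
    listed set inside W, important or not, while for v in Y completeness is what counts. The cut has
    to be the furthest one, since only then does forcing the head of a crossing arc to the source
    side raise the minimum. Deleting the tail lowers the budget by one, counted twice in 2k, and the
    minimum by at most one. At most k * k 2^(2k+1) <= 2^(4k+1) = M pairs of vertices must receive
    different colours. With q = 4M colours and 2Ml functions, where l is twice the rounded-up
    logarithm of n plus 1, two vertices collide under fewer than 2l functions, less than a fraction
    1/M, so one function serves all pairs. The q^k tuples of colours are the only source of k^2 in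
    the exponent. If T is empty, no separator exists and thinness says nothing, but Y is empty; for
    this the empty set always belongs to the output. Most functions are left folds and most
    repetition counts are lists, because this is how the program loops. *)

Definition darc : Type := (nat * nat)%type.

(** As a left fold it keeps the last match, exactly as the loop of the program does. *)
Definition search (T : Type) (p : pred T) (s : seq T) : option T :=
  foldl (fun r e => if p e then Some e else r) None s.

Lemma search_some (T : eqType) (p : pred T) s e :
  search p s = Some e -> e \in s /\ p e.
Proof.
rewrite /search -[s]revK foldl_rev mem_rev; elim: (rev s) => //= x r IH.
case: ifP => [px [<-]|_ /IH[]]; first by rewrite inE eqxx.
by rewrite inE => -> ->; rewrite orbT.
Qed.

Lemma isSome_search (T : Type) (p : pred T) s : isSome (search p s) = has p s.
Proof.
rewrite /search -[s]revK foldl_rev has_rev; elim: (rev s) => //= x r <-.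
by case: ifP.
Qed.

Definition lookup (V : Type) (x : nat) (B : seq (nat * V)) : option (nat * V) :=
  search (fun e => e.1 == x) B.

Lemma isSome_lookup V x (B : seq (nat * V)) :
  isSome (lookup x B) = (x \in unzip1 B).
Proof.
rewrite isSome_search; elim: B => //= e B ->.
by rewrite inE eq_sym.
Qed.

Lemma lookup_some (V : eqType) x (B : seq (nat * V)) e :
  lookup x B = Some e -> e \in B /\ e.1 = x.
Proof. by case/search_some => eB /eqP. Qed.

(** * Backward search from the targets *)

Section BackwardSearch.
Implicit Types (A : seq darc) (B : seq (nat * seq darc)).

(** An entry pairs a vertex with a list of arcs leading from it to a target. Existing entries are
    never replaced, which keeps the recorded walks simple. *)
Definition relax B (a : darc) :=
  if lookup a.1 B is Some _ then B else
  if lookup a.2 B is Some e then (a.1, a :: e.2) :: B else B.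

Definition bfs A B0 := foldl (fun B _ => foldl relax B A) B0 A.

Definition closed_under A (R : pred nat) : bool := all (fun a => R a.1 ==> R a.2) A.

Fixpoint walk (R : pred nat) (x : nat) (p : seq darc) : bool :=
  if p is a :: p' then (a.1 == x) && walk R a.2 p' else R x.

Lemma walk_closed A (R Q : pred nat) x p :
  walk R x p -> {subset p <= A} -> closed_under A Q -> Q x ->
  exists2 y, R y & Q y.
Proof.
elim: p x => [|a p IH] x /=; first by exists x.
case/andP => /eqP <- wp sub cl Qa; apply: (IH a.2) => //.
  by move=> b bp; apply: sub; rewrite inE bp orbT.
by move/allP/(_ a): cl => /(_ (sub _ _)); rewrite mem_head Qa => /(_ isT).
Qed.

(** Distinct tails make the arcs of a walk pairwise distinct, so that they can be reversed one after
    the other. The last clause preserves this when a walk is prolonged, and it bounds the length of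
    a walk by the number of entries. *)
Definition path_inv A (R : pred nat) B :=
  forall e, e \in B ->
  [/\ walk R e.1 e.2, {subset e.2 <= A}, uniq (unzip1 e.2)
    & {subset unzip1 e.2 <= unzip1 B}].

Lemma relax_keys B a :
  unzip1 (relax B a) =
  if (a.1 \notin unzip1 B) && (a.2 \in unzip1 B) then a.1 :: unzip1 B
  else unzip1 B.
Proof.
rewrite /relax -(isSome_lookup a.1) -(isSome_lookup a.2).
by case: (lookup a.1 B) => //=; case: (lookup a.2 B).
Qed.

Lemma relax_inv A R B a : a \in A -> path_inv A R B -> path_inv A R (relax B a).
Proof.
move=> aA inv; rewrite /relax.
case E1: (lookup a.1 B) => [//|]; case E2: (lookup a.2 B) => [e|//].
have nk : a.1 \notin unzip1 B by rewrite -isSome_lookup E1.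
have [eB ea] := lookup_some E2; have [we se ue ke] := inv _ eB.
move=> f; rewrite inE => /orP[/eqP ->|fB] /=.
  split; first by rewrite eqxx -ea.
  - by move=> b; rewrite inE => /orP[/eqP ->|/se].
  - by rewrite ue andbT; apply: contra nk => /ke.
  - move=> b; rewrite !inE => /orP[->//|/ke ->]; by rewrite orbT.
have [wf sf uf kf] := inv _ fB; split=> // b /kf; rewrite inE => ->.
by rewrite orbT.
Qed.

Lemma round_inv A R s B : {subset s <= A} ->
  path_inv A R B -> path_inv A R (foldl relax B s).
Proof.
elim: s B => //= a s IH B sub inv; apply: IH.
  by move=> b bs; apply: sub; rewrite inE bs orbT.
by apply: relax_inv => //; apply: sub; rewrite mem_head.
Qed.

Lemma bfs_inv A R B0 : path_inv A R B0 -> path_inv A R (bfs A B0).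
Proof.
rewrite /bfs; elim: {4}A B0 => //= _ s IH B inv.
by apply: IH; apply: round_inv.
Qed.

Lemma round_keys s B : {subset unzip1 B <= unzip1 (foldl relax B s)}.
Proof.
elim: s B => [|a s IH] B x xB //=; apply: IH; rewrite relax_keys.
by case: ifP; rewrite ?inE xB ?orbT.
Qed.

Lemma bfs_keys A B : {subset unzip1 B <= unzip1 (bfs A B)}.
Proof.
rewrite /bfs; elim: {2}A B => [|_ s IH] B x xB //=.
by apply/IH/round_keys.
Qed.

Lemma round_step s B a : a \in s -> a.2 \in unzip1 B ->
  a.1 \in unzip1 (foldl relax B s).
Proof.
elim: s B => //= b s IH B; rewrite inE => /orP[/eqP <-|aS] aB; last first.
  by apply: IH => //; apply: (@round_keys [:: b]).
apply: round_keys; rewrite relax_keys aB andbT.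
by case: ifP => [_|/negbFE//]; rewrite mem_head.
Qed.

Definition outside B : pred nat := [pred x | x \notin unzip1 B].

Lemma round_closed s A B : {subset s <= A} -> closed_under A (outside B) ->
  foldl relax B s = B.
Proof.
elim: s => //= a s IH sub cl; have -> : relax B a = B.
  move/allP/(_ a (sub _ (mem_head _ _))): cl; rewrite /relax /outside /= -!isSome_lookup.
  by case: (lookup a.1 B) => //=; case: (lookup a.2 B).
by apply: IH => // b bs; apply: sub; rewrite inE bs orbT.
Qed.

Lemma count_lt (T : eqType) (p q : pred T) s x :
  {in s, subpred p q} -> x \in s -> q x -> ~~ p x -> count p s < count q s.
Proof.
move=> sub xs qx px.
have -> : count p s = count p (filter q s).
  rewrite count_filter; apply: eq_in_count => y ys /=.
  by case E: (p y) => //=; rewrite (sub _ ys E).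
rewrite -[ltnRHS]size_filter ltn_neqAle count_size andbT -all_count.
by apply/allPn; exists x; rewrite // mem_filter qx.
Qed.

(* A round that is not yet stable discovers the tail of some new arc, so
   [size A] rounds reach a fixpoint. *)
Lemma bfs_closed A B0 : closed_under A (outside (bfs A B0)).
Proof.
pose phi B := count (fun a : darc => a.1 \notin unzip1 B) A.
pose F (B : seq (nat * seq darc)) (_ : darc) := foldl relax B A.
suff H s B : closed_under A (outside (foldl F B s)) \/
             phi (foldl F B s) + size s <= phi B.
  have [//|le] := H A B0; apply/allP => a aA; apply/implyP => /= na.
  have : phi B0 <= size A by apply: count_size.
  have : 0 < phi (foldl F B0 A) by rewrite -has_count; apply/hasP; exists a.
  lia.
elim: s B => [|b s IH] B /=; first by right; rewrite addn0.
have [cl|ncl] := boolP (closed_under A (outside B)).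
  left; have FB : F B b = B by apply: round_closed cl.
  rewrite FB; have -> : foldl F B s = B; last by [].
  elim: s {IH} => //= c s IH; have -> : F B c = B by apply: round_closed cl.
  by [].
have [|le] := IH (F B b); [by left|right].
suff : phi (F B b) < phi B by lia.
have /allPn[a aA] := ncl; rewrite negb_imply /= negbK => /andP[n1 n2].
apply: (count_lt _ aA) => //=; last by rewrite negbK; apply: round_step.
by move=> c _; apply: contra; apply: round_keys.
Qed.

Lemma size_relax B a : size (relax B a) <= (size B).+1.
Proof.
by rewrite /relax; case: (lookup a.1 B) => //; case: (lookup a.2 B) => /=.
Qed.

Lemma size_round s B : size (foldl relax B s) <= size B + size s.
Proof.
elim: s B => [|a s IH] B /=; first by rewrite addn0.
by apply: leq_trans (IH _) _; have := size_relax B a; lia.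
Qed.

Lemma size_bfs_from A (s : seq darc) B :
  size (foldl (fun B _ => foldl relax B A) B s) <= size B + size s * size A.
Proof.
elim: s B => [|a s IH] B /=; first by rewrite addn0.
by apply: leq_trans (IH _) _; have := size_round A B; lia.
Qed.

Lemma size_bfs A B : size (bfs A B) <= size B + size A * size A.
Proof. exact: size_bfs_from. Qed.

End BackwardSearch.

(** * Cut values, residual networks and the furthest minimum cut *)

Section Flow.
Implicit Types (A : seq darc) (R Q : pred nat).

Definition cutval A R := count (fun a : darc => R a.1 && ~~ R a.2) A.

Lemma cutval0 A R : cutval A R = 0 -> closed_under A R.
Proof.
move=> H; apply/allP => a aA; apply/implyP => Ra; apply/negPn/negP => nR.
suff : 0 < cutval A R by rewrite H.
by rewrite -has_count; apply/hasP; exists a; rewrite // Ra nR.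
Qed.

Lemma closed_cutval A R : closed_under A R -> cutval A R = 0.
Proof.
move=> cl; apply/eqP; rewrite eqn0Ngt -has_count; apply/hasPn => a aA.
by move/allP/(_ a aA): cl; case: (R a.1) => //= ->.
Qed.

Lemma perm_cutval A A' R : perm_eq A A' -> cutval A R = cutval A' R.
Proof. by move/permP; apply. Qed.

Lemma cutval_submod A R Q :
  cutval A (predI R Q) + cutval A (predU R Q) <= cutval A R + cutval A Q.
Proof.
elim: A => //= a A; rewrite /cutval /=.
by case: (R a.1); case: (R a.2); case: (Q a.1); case: (Q a.2) => /=; lia.
Qed.

Lemma cutval_mem A R a m : count_mem a A > m -> R a.1 -> ~~ R a.2 ->
  m < cutval A R.
Proof.
move=> lt Ra nR; apply: leq_trans lt _; apply: sub_count => b /eqP -> /=.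
by rewrite Ra nR.
Qed.

(* Removes one occurrence, up to the order of the remaining elements. *)
Definition rem_arc (a : darc) A : seq darc :=
  (foldl (fun fo b => if ~~ fo.1 && (b == a) then (true, fo.2)
                      else (fo.1, b :: fo.2)) (false, [::]) A).2.

Lemma perm_rem_arc a A : perm_eq (rem_arc a A) (rem a A).
Proof.
rewrite /rem_arc; set F := (X in foldl X).
have F1 s o : perm_eq (foldl F (true, o) s).2 (s ++ o).
  elim: s o => //= b s IH o; apply: perm_trans (IH _) _.
  by rewrite perm_catC /= perm_cons perm_catC.
suff H s o : perm_eq (foldl F (false, o) s).2 (rem a s ++ o).
  by rewrite -[rem a A]cats0.
elim: s o => //= b s IH o; rewrite /F /=; case: eqP => _ //=.
apply: perm_trans (IH _) _.
by rewrite perm_catC /= perm_cons perm_catC.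
Qed.

Lemma size_rem_arc a A : size (rem_arc a A) <= size A.
Proof. by rewrite (perm_size (perm_rem_arc a A)); apply: size_subseq (rem_subseq _ _). Qed.

(** The residual network after one more unit of flow along [p], the flow itself being forgotten. *)
Definition augment A (p : seq darc) :=
  foldl (fun A a => (a.2, a.1) :: rem_arc a A) A p.

Lemma augment_step A a : a \in A -> size ((a.2, a.1) :: rem_arc a A) = size A.
Proof.
move=> aA; rewrite /= (perm_size (perm_rem_arc a A)) size_rem //.
by case: A aA.
Qed.

Lemma augment_sub A a p : {subset a :: p <= A} -> a.1 \notin unzip1 p ->
  {subset p <= (a.2, a.1) :: rem_arc a A}.
Proof.
move=> sub na b bp; rewrite inE (perm_mem (perm_rem_arc a A)); apply/orP; right.
apply: rem_mem; last by apply: sub; rewrite inE bp orbT.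
by apply: contraNneq na => <-; apply: map_f.
Qed.

Lemma size_augment A p : {subset p <= A} -> uniq (unzip1 p) ->
  size (augment A p) = size A.
Proof.
elim: p A => //= a p IH A sub /andP[na up].
rewrite /augment /= -/(augment _ p) IH ?augment_step ?sub ?mem_head //.
exact: augment_sub.
Qed.

(* Reversing one arc [(x, y)] changes every cut value by [R y - R x], and this
   telescopes along the path. *)
Lemma cutval_augment A (T : pred nat) p x R :
  {subset p <= A} -> uniq (unzip1 p) -> walk T x p -> (forall y, T y -> ~~ R y) ->
  cutval (augment A p) R + R x = cutval A R.
Proof.
move=> + + + TR; elim: p A x => [|a p IH] A x /=.
  by move=> _ _ /TR /negbTE ->; rewrite addn0.
move=> sub /andP[na up] /andP[/eqP <- wp].
have aA : a \in A by rewrite sub ?mem_head.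
rewrite /augment /= -/(augment _ p).
have := IH ((a.2, a.1) :: rem_arc a A) a.2 (augment_sub sub na) up wp.
rewrite {2}/cutval /= -/(cutval _ R) (perm_cutval R (perm_rem_arc a A)).
have -> : cutval A R = cutval (a :: rem a A) R.
  by apply: perm_cutval; apply: perm_to_rem.
rewrite {3}/cutval /= -/(cutval _ R).
by case: (R a.1); case: (R a.2) => /=; lia.
Qed.

Variable B0 : seq (nat * seq darc).

Definition find_source (Src : seq nat) (B : seq (nat * seq darc)) :=
  foldl (fun r x => if lookup x B is Some e then Some e else r) None Src.

Lemma find_source_some Src B e :
  find_source Src B = Some e -> e \in B /\ e.1 \in Src.
Proof.
rewrite /find_source -[Src]revK foldl_rev mem_rev; elim: (rev Src) => //= x s IH.
case E: (lookup x B) => [f|]; last by move=> /IH[-> es]; rewrite inE es orbT.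
by case=> <-; have [-> ->] := lookup_some E; rewrite mem_head.
Qed.

Lemma find_source_none Src B :
  find_source Src B = None -> {in Src, forall x, x \notin unzip1 B}.
Proof.
rewrite /find_source -[Src]revK foldl_rev.
move=> + x; rewrite mem_rev; elim: (rev Src) => //= y s IH.
case E: (lookup y B) => [//|] /IH xs; rewrite inE => /orP[/eqP ->|/xs //].
by rewrite -isSome_lookup E.
Qed.

(** [j] bounds the number of augmentations. A source that still reaches a target after [j] of them
    shows that every cut exceeds [j], which is reported as [None]. *)
Fixpoint flow j A Src : option (seq (nat * seq darc)) :=
  let B := bfs A B0 in
  if find_source Src B is Some e then
    if j is j'.+1 then flow j' (augment A e.2) Src else None
  else Some B.

Definition targets : pred nat := mem (unzip1 B0).

Definition cut (Src : seq nat) R := all R Src && ~~ has R (unzip1 B0).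

Hypothesis B0_nil : forall e, e \in B0 -> e.2 = [::].

Lemma path_inv_bfs A : path_inv A targets (bfs A B0).
Proof.
apply: bfs_inv => e eB; rewrite (B0_nil eB) /=; split=> //.
by rewrite /targets /=; apply: map_f.
Qed.

Lemma cut_targets Src R : cut Src R -> forall y, targets y -> ~~ R y.
Proof. by case/andP => _ /hasPn. Qed.

Lemma cut_augment j A Src e R : find_source Src (bfs A B0) = Some e ->
  cut Src R -> cutval (augment A e.2) R + j.+1 = cutval A R + j.
Proof.
move=> /find_source_some[eB eS] cR.
have [we se ue _] := path_inv_bfs eB.
rewrite -(cutval_augment se ue we (cut_targets cR)).
have /andP[/allP/(_ _ eS) -> _] := cR; by rewrite addn1 addSnnS.
Qed.

(** A walk from [Q] to a target would stay in [Q], which avoids the targets. So the vertices cut off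
    from the targets form the largest closed set avoiding them; this is why searching backward
    yields the furthest cut. *)
Lemma bfs_max A Q : closed_under A Q -> (forall y, targets y -> ~~ Q y) ->
  subpred Q (outside (bfs A B0)).
Proof.
move=> clQ TQ x Qx; apply/negP => /mapP[e eB xe].
have [we se _ _] := path_inv_bfs eB; rewrite xe in Qx.
by have [y /TQ/negP] := walk_closed we se clQ Qx.
Qed.

Definition max_min_cut A Src B :=
  [/\ cut Src (outside B),
      forall Q, cut Src Q -> cutval A (outside B) <= cutval A Q
    & forall Q, cut Src Q -> cutval A Q <= cutval A (outside B) ->
      subpred Q (outside B)].

Lemma max_min_cut_bfs A Src : find_source Src (bfs A B0) = None ->
  cutval A (outside (bfs A B0)) = 0 /\ max_min_cut A Src (bfs A B0).
Proof.
move=> E; have R0 : cutval A (outside (bfs A B0)) = 0.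
  exact/closed_cutval/bfs_closed.
split=> //; split; rewrite ?R0 //.
  apply/andP; split; first by apply/allP; apply: find_source_none E.
  by apply/hasPn => y yT; rewrite /= negbK; apply: bfs_keys.
by move=> Q cQ; rewrite leqn0 => /eqP/cutval0 clQ; apply: bfs_max (cut_targets cQ).
Qed.

(** In the last residual network [outside B] has value 0, so it is a minimum cut and, as the largest
    closed set, contains all the others. Undoing an augmentation adds one to every cut alike, so
    both properties carry back to [A]. *)
Lemma flow_some j A Src B : flow j A Src = Some B ->
  cutval A (outside B) <= j /\ max_min_cut A Src B.
Proof.
elim: j A => [|j IH] A /=; case E: (find_source _ _) => [e|] //.
- by case=> <-; have [-> ?] := max_min_cut_bfs E.
- move=> /IH[c1 [c2 c3 c4]]; have cA := cut_augment j E.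
  have H1 := cA _ c2; split; first by lia.
  split=> //.
    by move=> Q cQ; have := cA _ cQ; have := c3 _ cQ; lia.
  by move=> Q cQ le; apply: c4 => //; have := cA _ cQ; lia.
- by case=> <-; have [-> ?] := max_min_cut_bfs E.
Qed.

Lemma flow_none j A Src Q : flow j A Src = None -> cut Src Q -> j < cutval A Q.
Proof.
elim: j A => [|j IH] A /=; case E: (find_source _ _) => [e|] //.
  by move=> _ /(cut_augment 0 E); lia.
by move=> fl cQ; have := cut_augment 0 E cQ; have := IH _ fl cQ; lia.
Qed.

End Flow.

(** * Enumerating important separators *)

Definition crossing (A : seq darc) (B : seq (nat * seq darc)) : option darc :=
  search (fun a => (a.1 \notin unzip1 B) && (a.2 \in unzip1 B)) A.

Lemma crossing_none A B a : crossing A B = None -> a \in A ->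
  outside B a.1 -> outside B a.2.
Proof.
move=> Ec aA; have := isSome_search
  (fun a : darc => (a.1 \notin unzip1 B) && (a.2 \in unzip1 B)) A.
rewrite -/(crossing A B) Ec => /esym/negbT/hasPn/(_ a aA).
by rewrite /outside /= negb_and => /orP[/negPf ->|].
Qed.

(** [A] is the network without the vertices in [D]. Branches that run out of the fuel [m], or whose
    minimum cut exceeds [k], contribute nothing; one branch receives the result of the other as its
    accumulator. *)
Fixpoint tree B0 k m (A : seq darc) (D Src : seq nat) (acc : seq (seq nat)) :=
  if m is m'.+1 then
    if flow B0 k A Src is Some B then
      if crossing A B is Some a then
        tree B0 k m' (rem_arc a A) (a.1 :: D) Src
          (tree B0 k m' A D (a.2 :: Src) acc)
      else D :: acc
    else acc
  else acc.

Lemma tree_acc B0 k m A D Src acc : {subset acc <= tree B0 k m A D Src acc}.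
Proof.
elim: m A D Src acc => [|m IH] A D Src acc E Eacc //=.
case: flow => [B|] //; case: crossing => [a|]; last by rewrite inE Eacc orbT.
by apply: (IH); apply: (IH).
Qed.

Lemma size_tree B0 k m A D Src acc :
  size (tree B0 k m A D Src acc) <= 2 ^ m + size acc.
Proof.
elim: m A D Src acc => [|m IH] A D Src acc /=; first by lia.
have : 0 < 2 ^ m by rewrite expn_gt0.
rewrite expnS; case: flow => [B|]; last by lia.
case: crossing => [a|] /=; last by lia.
move: (IH (rem_arc a A) (a.1 :: D) Src (tree B0 k m A D (a.2 :: Src) acc)).
move: (IH A D (a.2 :: Src) acc); lia.
Qed.

Lemma connect_ind (V : finType) (e : rel V) (I : pred V) x y :
  (forall a b, I a -> e a b -> I b) -> connect e x y -> I x -> I y.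
Proof.
move=> step /connectP[p + ->]; elim: p x => //= z p IH x /andP[exz zp] Ix.
by apply: IH zp _; apply: step exz.
Qed.

Lemma mem_reach1 (G : digraph) (W : {set vertex G}) v u :
  (u \in reach W [set v]) = (v \notin W) && connect (edge_minus W) v u.
Proof.
rewrite inE; apply/exists_inP/idP => [[x]|H]; first by rewrite inE => /eqP ->.
by exists v; rewrite ?inE.
Qed.

Lemma reach1_ind (G : digraph) (W : {set vertex G}) (I : pred (vertex G)) v u :
  (v \notin W -> I v) ->
  (forall a b, a \in reach W [set v] -> I a -> edge a b -> b \notin W -> I b) ->
  u \in reach W [set v] -> I u.
Proof.
rewrite mem_reach1 => Iv step /andP[vW c].
suff /andP[] : (u \in reach W [set v]) && I u by [].
apply: (@connect_ind _ _ [pred u | (u \in reach W [set v]) && I u] v u _ c).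
  move=> a b /andP[ra Ia] eab; move: (eab) => /and3P[e1 _ bW].
  rewrite /= (step a) // andbT; move: ra; rewrite !mem_reach1 => /andP[-> ca] /=.
  exact: connect_trans (connect1 eab).
by rewrite /= mem_reach1 vW connect0 Iv.
Qed.

Lemma reach1_notin (G : digraph) (W : {set vertex G}) v u :
  u \in reach W [set v] -> u \notin W.
Proof. by apply: (reach1_ind (I := [pred u | u \notin W])). Qed.

Lemma reach1_step (G : digraph) (W : {set vertex G}) v u w :
  u \in reach W [set v] -> edge u w -> w \notin W -> w \in reach W [set v].
Proof.
move=> ru euw wW; have uW := reach1_notin ru.
move: ru; rewrite !mem_reach1 => /andP[-> c] /=; apply: connect_trans c _.
by apply: connect1; rewrite /edge_minus /= euw uW wW.
Qed.

(* [lia] restricted to the arithmetic hypotheses; the other ones can be very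
   costly to preprocess. *)
Ltac nlia :=
  repeat match goal with
  | H : ?P |- _ => lazymatch P with
      | is_true (_ <= _) => revert H
      | is_true (_ < _) => revert H
      | @eq nat _ _ => revert H
      | _ => clear H
      end
  end; lia.

(** * Branching in the vertex-splitting network *)

Section ImportantTree.
Variables (G : digraph) (T : {set vertex G}) (k : nat).
Variables (arcs : seq darc) (B0 : seq (nat * seq darc)).
Notation n := (nb_vertices G).
Implicit Types (D E Src : seq nat) (A : seq darc) (Q : pred nat).

Hypothesis B0_nil : forall e, e \in B0 -> e.2 = [::].
Hypothesis B0P : forall x : nat,
  reflect (exists2 t : vertex G, t \in T & x = t :> nat) (x \in unzip1 B0).
Hypothesis arcsP : forall a, a \in arcs ->
  (exists u w : vertex G, edge u w /\ a = (n + u, w : nat)) \/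
  (exists u : vertex G, a = (u : nat, n + u)).
Hypothesis arcs_edge : forall u w : vertex G, edge u w ->
  k < count_mem (n + u, w : nat) arcs.
Hypothesis arcs_undel : forall u : vertex G, u \in undeletable G ->
  k < count_mem (u : nat, n + u) arcs.
Hypothesis arcs_del : forall u : vertex G, u \notin undeletable G ->
  count (fun a : darc => a.1 == u) arcs = 1.
Hypothesis arcs_vertex : forall u : vertex G, (u : nat, n + u) \in arcs.

(** The number [u] below [n] is the entry node of the vertex [u], and [n + u] its exit node. The
    only arcs with an entry node as tail are splitting arcs, so for a list of vertices this filter
    amounts to deleting them from the graph. *)
Definition minus (D : seq nat) := [seq a <- arcs | a.1 \notin D].

Definition vset (D : seq nat) : {set vertex G} := [set u : vertex G | (u : nat) \in D].

Definition valid (v : vertex G) (D : seq nat) :=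
  {in D, forall x, exists u : vertex G,
     [/\ x = u :> nat, u \notin T, u \notin undeletable G & u != v]}.

Lemma eq_minus D D' : D =i D' -> minus D = minus D'.
Proof. by move=> eqD; apply: eq_filter => a; rewrite eqD. Qed.

Lemma vset_valid v D : valid v D ->
  vset D \subset ~: ([set v] :|: T :|: undeletable G).
Proof.
move=> vD; apply/subsetP => u; rewrite !inE => /vD[w [/val_inj <- wT wU wv]].
by rewrite (negPf wv) (negPf wT) (negPf wU).
Qed.

Lemma closed_minus D (Q : pred nat) a : closed_under (minus D) Q ->
  a \in arcs -> a.1 \notin D -> Q a.1 -> Q a.2.
Proof.
move=> cl aA aD; move/allP/(_ a): cl; rewrite mem_filter aD aA => /(_ isT).
by move/implyP.
Qed.

Lemma mem_arcs_edge (u w : vertex G) : edge u w -> (n + u, w : nat) \in arcs.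
Proof.
by move=> euw; rewrite -has_pred1 has_count; apply: leq_ltn_trans (arcs_edge euw).
Qed.

(** A path leaving [v] through its exit node cannot escape [Q]: an edge leads to an entry node in
    [Q], and the splitting arc of a vertex outside [D] leads on to its exit node. *)
Lemma closed_separator v D (Q : pred nat) : T != set0 -> v \notin T ->
  valid v D -> closed_under (minus D) Q -> Q (n + v) ->
  (forall t : vertex G, t \in T -> ~~ Q t) -> separator [set v] T (vset D).
Proof.
move=> T0 vT vD cl Qv TQ; apply/and5P; split=> //.
- by apply/set0Pn; exists v; rewrite inE.
- by rewrite disjoints1.
- exact: vset_valid.
apply/forall_inP => a; rewrite inE => /eqP ->; apply/forall_inP => t tT.
(* Only the exit node of [v] is known to lie in [Q], whence the separate disjunct. *)
pose I := [pred u : vertex G | (u == v) || Q u && Q (n + u)].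
have step u w : I u -> edge_minus (vset D) u w -> I w.
  move=> /= Iu; rewrite /edge_minus /= !inE => /and3P[euw uD wD].
  have Qu : Q (n + u) by case/orP: Iu => [/eqP ->//|/andP[]].
  have Qw : Q w.
    apply: (closed_minus cl (mem_arcs_edge euw)) Qu => /=.
    by apply/negP => /vD[x [/= nx _ _ _]]; have := ltn_ord x; rewrite -nx ltnNge leq_addr.
  by rewrite Qw (closed_minus cl (arcs_vertex w)) ?orbT.
apply/negP => vt; have := connect_ind step vt; rewrite /= eqxx (negPf (TQ _ tT)).
by case/(_ isT)/orP => // /eqP tv; rewrite tv (negPf vT) in tT.
Qed.

Lemma count_minus D a : a.1 \notin D -> count_mem a (minus D) = count_mem a arcs.
Proof.
move=> aD; rewrite count_filter; apply: eq_count => b /=.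
by case: eqP => //= ->; rewrite aD.
Qed.

(** Arcs repeated more than [k] times cannot leave a set whose cut value is at most [k]; what
    remains are splitting arcs of deletable vertices. *)
Lemma crossing_vertex v D (Q : pred nat) a : valid v D -> cutval (minus D) Q <= k ->
  a \in minus D -> Q a.1 -> ~~ Q a.2 ->
  exists u : vertex G, [/\ a = (u : nat, n + u), u \notin undeletable G & (u : nat) \notin D].
Proof.
move=> vD le; rewrite mem_filter => /andP[aD aA] Q1 Q2.
have small : count_mem a arcs <= k.
  rewrite leqNgt; apply/negP => lt; rewrite -(count_minus aD) in lt.
  by have := cutval_mem lt Q1 Q2; lia.
have [[u [w [euw ea]]]|[u ea]] := arcsP aA.
  by have := arcs_edge euw; rewrite -ea ltnNge small.
exists u; split=> //; last by rewrite ea in aD.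
by apply/negP => /arcs_undel; rewrite -ea ltnNge small.
Qed.

Lemma cutval_minus_cons (u : vertex G) D Q : u \notin undeletable G ->
  cutval (minus D) Q <= cutval (minus ((u : nat) :: D)) Q + 1.
Proof.
move=> /arcs_del <-; rewrite /cutval !count_filter.
rewrite -(count_predUI _ (fun a : darc => a.1 == u)).
apply: leq_trans (leq_addr _ _); apply: sub_count => a /=.
rewrite inE; case: (_ == _); case: (Q a.1) => //=; last by rewrite orbF.
by rewrite orbT.
Qed.

Lemma cutval_minus_cat v E D Q : valid v E ->
  cutval (minus D) Q <= cutval (minus (E ++ D)) Q + size E.
Proof.
elim: E => [|x E IH] vE /=; first by rewrite addn0.
have /IH le : valid v E by move=> y yE; apply: vE; rewrite inE yE orbT.
have [u [-> _ uU _]] := vE x (mem_head _ _).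
by have := cutval_minus_cons (E ++ D) Q uU; lia.
Qed.

(** The splitting arc of a deletable vertex occurs once and is the only arc with that tail, so
    removing one occurrence agrees with filtering by tails. *)
Lemma perm_rem_minus (u : vertex G) D A : u \notin undeletable G ->
  (u : nat) \notin D -> perm_eq A (minus D) ->
  perm_eq (rem_arc (u : nat, n + u) A) (minus ((u : nat) :: D)).
Proof.
move=> uU uD pA; set a := (_, _).
have aA : a \in A by rewrite (perm_mem pA) mem_filter /= uD arcs_vertex.
rewrite (permPl (perm_rem_arc a A)) -(perm_cons a).
rewrite -(permPl (perm_to_rem aA)) (permPl pA).
have -> : minus ((u : nat) :: D) = [seq b <- minus D | b != a].
  rewrite /minus -filter_predI; apply: eq_in_filter => b bA /=.
  rewrite inE negb_or; congr (_ && _).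
  apply/idP/idP; first by apply: contra => /eqP ->.
  apply: contra => /eqP bu; have [[x [y [_ eb]]]|[x eb]] := arcsP bA.
    by move: bu; rewrite eb /= => bu; have := ltn_ord u; lia.
  by move: bu; rewrite eb /= => /val_inj ->.
rewrite -(perm_filterC (pred1 a) (minus D)).
have -> : [seq x <- minus D | pred1 a x] = [:: a].
  have -> : [:: a] = nseq (count_mem a (minus D)) a.
    rewrite count_minus //; suff -> : count_mem a arcs = 1 by [].
    apply/eqP; rewrite eqn_leq -{1}(arcs_del uU) -has_count has_pred1 arcs_vertex.
    by rewrite andbT; apply: sub_count => b /eqP -> /=.
  rewrite -size_filter; apply/all_pred1P; exact: filter_all.
by [].
Qed.

Lemma tree_sound v m A D Src acc E : T != set0 -> v \notin T ->
  valid v D -> perm_eq A (minus D) -> (v : nat) \in Src -> n + v \in Src ->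
  E \in tree B0 k m A D Src acc ->
  E \in acc \/ (valid v E /\ separator [set v] T (vset E)).
Proof.
move=> T0 vT; elim: m A D Src acc => [|m IH] A D Src acc vD pA vS nvS /=; first by left.
case Ef: flow => [B|]; last by left.
have [le [cB _ _]] := flow_some B0_nil Ef.
have BT t : t \in T -> ~~ outside B (nat_of_ord t).
  by move=> tT; apply: (cut_targets cB); rewrite /targets /=; apply/B0P; exists t.
have /andP[/allP cS _] := cB.
rewrite (perm_cutval _ pA) in le.
case Ec: crossing => [a|]; last first.
  rewrite inE => /orP[/eqP ->|]; [right; split=> //|by left].
  apply: (closed_separator (Q := outside B)) => //; last exact: cS.
  apply/allP => a; rewrite -(perm_mem pA) => aA; apply/implyP.
  exact: crossing_none Ec aA.
have [aA /andP[a1 a2]] := search_some Ec.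
have aD : a \in minus D by rewrite -(perm_mem pA).
have [|u [ea uU uD]] := crossing_vertex vD le aD a1; first by rewrite /= negbK.
rewrite ea /= in a1 a2 aA *.
(* [u] is no target because its entry node lies on the source side, and it is not [v] because its
   exit node does not. *)
have vD' : valid v ((u : nat) :: D).
  move=> x; rewrite inE => /orP[/eqP ->|/vD //]; exists u; split=> //.
    by apply/negP => /BT; rewrite /outside /= a1.
  by apply/eqP => uv; have := cS _ nvS; rewrite /outside /= -uv a2.
move=> /(IH _ _ _ _ vD' (perm_rem_minus uU uD pA) vS nvS)[|]; last by right.
by apply: IH => //; rewrite inE ?vS ?nvS orbT.
Qed.

(** * Small important separators occur among the leaves *)

Section Completeness.
Variables (v : vertex G) (S : {set vertex G}).
Hypothesis impS : important_separator [set v] T S.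

Let s := [seq nat_of_ord u | u <- enum S].
(** All nodes that cannot reach a target once [S] is deleted, not merely those reachable from [v]:
    as the largest closed set it is comparable with cuts pushed as far as possible. *)
Let RS : pred nat := outside (bfs (minus s) B0).

Lemma mem_important (u : vertex G) : ((u : nat) \in s) = (u \in S).
Proof. by rewrite mem_map ?mem_enum //; apply: val_inj. Qed.

Lemma important_is_separator : separator [set v] T S. Proof. by case: impS => [[]]. Qed.

Lemma important_targets : T != set0. Proof. by case/and5P: important_is_separator. Qed.

Lemma important_source : v \notin T.
Proof. by case/and5P: important_is_separator => _ _; rewrite disjoints1. Qed.

Lemma important_sub u : u \in S -> [/\ u \notin T, u \notin undeletable G & u != v].
Proof.
case/and5P: important_is_separator => _ _ _ /subsetP sub _ /sub; rewrite !inE !negb_or.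
by case/andP => /andP[-> ->] ->.
Qed.

Lemma important_valid : valid v s.
Proof.
by move=> x /mapP[u]; rewrite mem_enum => /important_sub[uT uU uv] ->; exists u.
Qed.

Lemma vset_important : vset s = S.
Proof. by apply/setP => u; rewrite inE mem_important. Qed.

Lemma size_important : size s = #|S|. Proof. by rewrite size_map cardE. Qed.

Lemma important_disconnects t : t \in T -> ~~ connect (edge_minus S) v t.
Proof.
case/and5P: important_is_separator => _ _ _ _ /forall_inP/(_ v); rewrite inE eqxx.
by move=> /(_ isT)/forall_inP; apply.
Qed.

Lemma targets_RS (t : nat) : targets B0 t -> ~~ RS t.
Proof. by move=> tT; rewrite /RS /outside /= negbK; apply: bfs_keys. Qed.

Lemma RS_closed : closed_under (minus s) RS. Proof. exact: bfs_closed. Qed.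

(** [K] is an explicit closed set without targets: the entry nodes of [S], and both nodes of each
    vertex outside [S] that has no path to [T] avoiding [S]. Maximality of [RS] does the rest. *)
Lemma RS_source : RS v /\ RS (n + v).
Proof.
pose away u := [forall t in T, ~~ connect (edge_minus S) u t].
pose K : pred nat := [pred x : nat |
  [exists u : vertex G, (x == u) && ((u \in S) || away u)] ||
  [exists u : vertex G, [&& x == n + u, u \notin S & away u]]].
have Kin (u : vertex G) : K u = (u \in S) || away u.
  apply/idP/idP => [/orP[/existsP[w /andP[/eqP e H]]|/existsP[w /andP[/eqP e _]]]|H].
  - by have -> : u = w by apply: val_inj.
  - by move: e => /= e; have := ltn_ord u; lia.
  - by apply/orP; left; apply/existsP; exists u; rewrite eqxx.
have Kout (u : vertex G) : K (n + u) = (u \notin S) && away u.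
  apply/idP/idP => [/orP[/existsP[w /andP[/eqP e _]]|/existsP[w /andP[/eqP e H]]]|H].
  - by move: e => /= e; have := ltn_ord w; lia.
  - by have -> : u = w by apply: val_inj => /=; move: e => /=; lia.
  - by apply/orP; right; apply/existsP; exists u; rewrite eqxx.
have vS : v \notin S by apply/negP => /important_sub[_ _]; rewrite eqxx.
have av : away v by apply/forall_inP => t; apply: important_disconnects.
have KT y : targets B0 y -> ~~ K y.
  rewrite /targets /= => /B0P[t tT ->].
  rewrite Kin negb_or; apply/andP; split; first by apply: contraL tT => /important_sub[].
  by apply/negP => /forall_inP/(_ t tT); rewrite connect0.
have clK : closed_under (minus s) K.
  apply/allP => a; rewrite mem_filter => /andP[aS aA]; apply/implyP.
  have [[u [w [euw ea]]]|[u ea]] := arcsP aA; rewrite ea in aS *.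
    rewrite Kout Kin => /andP[uS /forall_inP au].
    have [//|wS] := boolP (w \in S); apply/forall_inP => t tT.
    apply: contra (au t tT); apply: connect_trans; apply: connect1.
    by rewrite /edge_minus /= euw uS wS.
  by rewrite /= mem_important in aS; rewrite /= Kin Kout (negPf aS).
have sub := bfs_max B0_nil clK KT.
by split; apply: sub; rewrite ?Kin ?Kout ?vS av ?orbT.
Qed.

Lemma important_minimal (D : seq nat) : valid v D -> {subset D <= s} ->
  separator [set v] T (vset D) -> D =i s.
Proof.
move=> vD sub sepD.
have subD : vset D \subset S.
  by apply/subsetP => u; rewrite inE => /sub; rewrite mem_important.
have eqD : vset D = S.
  apply/eqP; case: (eqVproper subD) => [->//|pr].
  by case: impS => -[_ /(_ _ pr)]; rewrite sepD.
move=> x; apply/idP/idP => [/sub //|/mapP[u]]; rewrite mem_enum => uS ->.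
by rewrite -eqD inE in uS.
Qed.

Lemma source_notin_important : v \notin S.
Proof. by apply/negP => /important_sub[_ _]; rewrite eqxx. Qed.

Lemma reach_RS u : u \in reach S [set v] -> RS (n + u).
Proof.
apply: (reach1_ind (I := [pred u : vertex G | RS (n + u)])) => [_|a b _ /= Ra eab bS].
  by case: RS_source.
have Rb : RS b.
  apply: (closed_minus RS_closed (mem_arcs_edge eab)) Ra => /=.
  by apply/mapP => -[x _ e]; have := ltn_ord x; lia.
by apply: (closed_minus RS_closed (arcs_vertex b)); rewrite //= mem_important.
Qed.

(** Otherwise putting [u] back would not enlarge what [v] reaches, and [S] without [u] would still
    separate, against minimality. *)
Lemma important_tight u : u \in S -> exists2 w, w \in reach S [set v] & edge w u.
Proof.
move=> uS; apply/exists_inP; apply: contraTT isT => /exists_inPn no.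
have pr : S :\ u \proper S by apply: properD1.
case: impS => -[_ /(_ _ pr) nsep] _; apply: contraNN nsep => _.
apply/and5P; case/and5P: important_is_separator => A0 _ dis sub _.
split=> //; first exact: important_targets.
  by apply: subset_trans sub; apply: subD1set.
apply/forall_inP => a; rewrite inE => /eqP ->; apply/forall_inP => t tT.
apply/negP => c; suff : t \in reach S [set v].
  by rewrite mem_reach1 (negPf (important_disconnects tT)) andbF.
apply: (@reach1_ind _ (S :\ u) (mem (reach S [set v])) v t) => [_|a' b _ /= ra eab|].
- by rewrite /= mem_reach1 source_notin_important connect0.
- rewrite in_setD1 negb_and negbK => /orP[/eqP bu|]; last exact: reach1_step eab.
  by have := no _ ra; rewrite -bu eab.
- by rewrite mem_reach1 c !inE (negPf source_notin_important) andbF.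
Qed.

(* The vertices crossing [Q], together with [D], form a separator [S'] no
   larger than [S] and pushed at least as far; importance of [S] forces
   [S' = S], so [Q] is closed in [G \ S]. *)
Lemma important_max D (Q : pred nat) : uniq D -> {subset D <= s} -> #|S| <= k ->
  subpred RS Q -> (forall y, targets B0 y -> ~~ Q y) ->
  cutval (minus D) Q + size D <= #|S| -> subpred Q RS.
Proof.
move=> uD Ds Sk RQ TQ le.
have vD : valid v D by move=> x /Ds/important_valid.
have QT (t : vertex G) : t \in T -> ~~ Q t.
  by move=> tT; apply: TQ; rewrite /targets /=; apply/B0P; exists t.
pose E := [seq a.1 | a <- minus D & Q a.1 && ~~ Q a.2].
have EP x : x \in E -> exists u : vertex G,
    [/\ x = u :> nat, u \notin undeletable G, Q u & ~~ Q (n + u)].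
  case/mapP => a; rewrite mem_filter => /andP[/andP[a1 a2] aD] ->.
  have [|u [ea uU _]] := crossing_vertex vD _ aD a1 a2; first by lia.
  by rewrite ea /= in a1 a2 *; exists u.
have vED : valid v (E ++ D).
  move=> x; rewrite mem_cat => /orP[/EP[u [-> uU Qu nQ]]|/vD //].
  exists u; split=> //; first by apply: contraL Qu; apply: QT.
  by apply: contraNneq nQ => ->; apply: RQ; case: RS_source.
have clQ : closed_under (minus (E ++ D)) Q.
  apply/allP => a; rewrite mem_filter mem_cat negb_or -andbA => /and3P[aE aD aA].
  apply/implyP => Qa; apply: contraR aE => nQ.
  by apply: map_f; rewrite !mem_filter Qa nQ aD aA.
set S' := vset (E ++ D).
have sepS' : separator [set v] T S'.
  apply: (closed_separator important_targets important_source (Q := Q)) => //.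
  by apply: RQ; case: RS_source.
have cS' : #|S'| <= #|S|.
  apply: leq_trans le; have <- : size (E ++ D) = cutval (minus D) Q + size D.
    by rewrite size_cat size_map size_filter.
  rewrite cardE -(size_map (@nat_of_ord n)); apply: uniq_leq_size.
    by rewrite map_inj_uniq ?enum_uniq //; apply: val_inj.
  by move=> x /mapP[u]; rewrite mem_enum inE => uE ->.
have RS_in (u : vertex G) : RS (n + u) -> u \notin S -> u \notin S'.
  move=> Ru uS; rewrite inE mem_cat negb_or; apply/andP; split; last first.
    by apply: contra uS => /Ds; rewrite mem_important.
  by apply/negP => /EP[w [/val_inj <- _ _ /negP[]]]; apply: RQ.
have sub : reach S [set v] \subset reach S' [set v].
  have vS' : v \notin S' by apply: RS_in source_notin_important; case: RS_source.
  apply/subsetP => u.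
  apply: (reach1_ind (I := mem (reach S' [set v]))) => [_|a b ra /= ra' eab bS].
    by rewrite /= mem_reach1 vS' connect0.
  have rb := reach1_step ra eab bS; apply: reach1_step ra' eab _.
  exact: RS_in (reach_RS rb) bS.
have eqR : reach S [set v] = reach S' [set v].
  apply/eqP; case: (eqVproper sub) => [->//|pr].
  by case: impS => _ []; exists S'.
(* A vertex of [S] missing from [S'] would be entered from the common reachable set and so belong to
   it, although that set avoids [S]. *)
have SS' : S \subset S'.
  apply/subsetP => u uS; have [w rw ewu] := important_tight uS.
  apply: contraLR uS => uS'; apply: (@reach1_notin _ _ v).
  by rewrite eqR; apply: reach1_step ewu uS'; rewrite -eqR.
have /eqP eqS : S == S' by rewrite eqEcard SS'.
have eqD : E ++ D =i s.
  move=> x; apply/idP/idP => [xE|/mapP[u]]; last first.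
    by rewrite mem_enum {1}eqS inE => uE ->.
  by have [u [xu _ _ _]] := vED x xE; rewrite xu mem_important eqS inE -xu.
by apply: (bfs_max B0_nil) => //; rewrite -(eq_minus eqD).
Qed.

Lemma cut_RS Src : all RS Src -> cut B0 Src RS.
Proof. by move=> H; rewrite /cut H; apply/hasPn => y /targets_RS. Qed.

(** [RS] is closed once all of [S] is deleted, and each vertex of [S] not yet in [D] accounts for at
    most one arc leaving it. *)
Lemma cutval_minus_RS D : uniq D -> {subset D <= s} ->
  cutval (minus D) RS + size D <= #|S|.
Proof.
move=> uD Ds; pose E := [seq x <- s | x \notin D].
have us : uniq s by rewrite map_inj_uniq ?enum_uniq //; apply: val_inj.
have eqED : E ++ D =i s.
  move=> x; rewrite mem_cat mem_filter; case: (boolP (x \in D)) => [/Ds ->|] //=.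
  by rewrite orbF.
have vE : valid v E by move=> x; rewrite mem_filter => /andP[_ /important_valid].
have := cutval_minus_cat D RS vE; rewrite (eq_minus eqED) (closed_cutval RS_closed).
have -> : #|S| = size (E ++ D).
  rewrite -size_important; apply: perm_size; apply: uniq_perm => //.
  rewrite cat_uniq uD filter_uniq //= andbT; apply/hasPn => x xD.
  by rewrite mem_filter xD.
by rewrite size_cat leq_add2r.
Qed.

(** [k'] bounds the vertices of [S] still to be deleted, [l] bounds the minimum cut from below, and
    the fuel exceeds [2 * k' - l]. As [RS] is a cut of value at most [k'], always [l <= k'], so the
    fuel cannot run out. The branch to follow depends on whether the crossing vertex belongs to
    [S]. *)
Lemma tree_complete m A D Src acc k' l :
  #|S| <= k -> perm_eq A (minus D) -> uniq D -> {subset D <= s} ->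
  #|S| <= k' + size D -> all RS Src -> (v : nat) \in Src -> n + v \in Src ->
  (forall Q, cut B0 Src Q -> l <= cutval A Q) -> k'.*2 < m + l ->
  exists2 E, E \in tree B0 k m A D Src acc & vset E = S.
Proof.
move=> Sk; elim: m A D Src acc k' l => [|m IH] A D Src acc k' l pA uD Ds Dk
  RSrc vS nvS lP lt.
  have := lP _ (cut_RS RSrc); rewrite (perm_cutval _ pA).
  move: (cutval_minus_RS uD Ds) lt Dk; rewrite -muln2.
  by nlia.
have vD : valid v D by move=> x /Ds/important_valid.
have leRS := cutval_minus_RS uD Ds; have cRS := cut_RS RSrc.
rewrite /=; case Ef: flow => [B|]; last first.
  by have := flow_none B0_nil Ef cRS; rewrite (perm_cutval _ pA); nlia.
have [le [cB minB maxB]] := flow_some B0_nil Ef.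
(* Uncrossing: the intersection with [RS] is again a cut, hence has at least the minimum value, and
   submodularity bounds the union by the value of [RS]. Importance of [S] then keeps the union
   inside [RS]. *)
have subB : subpred (outside B) RS.
  suff: subpred (predU (outside B) RS) RS.
    by move=> H x Bx; apply: H; rewrite /= Bx.
  apply: (important_max uD Ds Sk).
  - by move=> x Rx; rewrite /= Rx orbT.
  - by move=> y Ty; rewrite /= negb_or (cut_targets cB Ty) (cut_targets cRS Ty).
  have := cutval_submod (minus D) (outside B) RS.
  have cI : cut B0 Src (predI (outside B) RS).
    have /andP[/allP B1 /hasPn B2] := cB; have /andP[/allP R1 _] := cRS.
    apply/andP; split; first by apply/allP => x xS; rewrite /= B1 ?R1.
    by apply/hasPn => y yT; rewrite /= negb_and B2.
  by have := minB _ cI; rewrite !(perm_cutval _ pA); nlia.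
have BT (t : vertex G) : t \in T -> ~~ outside B t.
  by move=> tT; apply: (cut_targets cB); rewrite /targets /=; apply/B0P; exists t.
have /andP[/allP cS _] := cB.
case Ec: crossing => [a|]; last first.
  exists D; first exact: mem_head.
  have eqD : D =i s.
    apply: important_minimal => //.
    apply: (closed_separator important_targets important_source (Q := outside B)) => //.
      apply/allP => a; rewrite -(perm_mem pA) => aA; apply/implyP.
      exact: crossing_none Ec aA.
    exact: cS.
  by rewrite -vset_important; apply/setP => u; rewrite !inE eqD.
have [aA /andP[a1 a2]] := search_some Ec.
have aD : a \in minus D by rewrite -(perm_mem pA).
have a2' : ~~ outside B a.2 by rewrite /outside /= negbK.
have cut_gt0 : 0 < cutval A (outside B).
  by rewrite -has_count; apply/hasP; exists a => //; rewrite a2' andbT.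
have leB := lP _ cB.
have [|u [ea uU uD']] := crossing_vertex vD _ aD a1 a2'.
  by rewrite -(perm_cutval _ pA).
have [uS|uS] := boolP (u \in S).
  have us : {subset a.1 :: D <= s}.
    by move=> x; rewrite inE => /orP[/eqP ->|/Ds //]; rewrite ea /= mem_important.
  have ua : uniq (a.1 :: D) by rewrite /= uD ea uD'.
  have := uniq_leq_size ua us; rewrite /= size_important => ltD.
  (* Deletion lowers [k'] by one and the minimum cut by at most one, so [2 * k' - l] loses at least
     one. *)
  apply: (IH _ _ _ _ k'.-1 (cutval A (outside B)).-1) => //.
  - by rewrite ea; apply: perm_rem_minus.
  - by move: Dk; rewrite /=; nlia.
  - move=> Q cQ; have := minB _ cQ; rewrite ea !(perm_cutval _ pA).
    rewrite (perm_cutval _ (perm_rem_minus uU uD' pA)).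
    by have := cutval_minus_cons D Q uU; nlia.
  - by move: lt leB cut_gt0 ltD Dk; rewrite -!muln2; nlia.
(* Every minimum cut lies in [outside B], which misses [a.2]; hence a cut containing [a.2] exceeds
   the minimum, and [l] rises while [k'] stays. *)
have [E Et eqE] : exists2 E, E \in tree B0 k m A D (a.2 :: Src) acc & vset E = S.
  apply: (IH _ _ _ _ k' (cutval A (outside B)).+1) => //; last by nlia.
  - rewrite /= RSrc andbT; move: (subB _ a1); rewrite ea /=.
    by apply: (closed_minus RS_closed (arcs_vertex u)); rewrite /= mem_important.
  - by rewrite inE vS orbT.
  - by rewrite inE nvS orbT.
  - move=> Q; rewrite /cut /= -andbA => /andP[Qa cQ].
    rewrite ltnNge; apply/negP => /(maxB _ cQ)/(_ _ Qa).
    by rewrite (negPf a2').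
by exists E => //; apply: tree_acc.
Qed.

End Completeness.
End ImportantTree.

(** * Greedy hashing *)

Section GreedyHashing.
Implicit Types (h : seq (nat * nat)) (H : seq (seq (nat * nat))).
Variables (colors vs : seq nat).

Definition color h x := if lookup x h is Some e then e.2 else 0.

Definition weight H x y :=
  foldl (fun w h => if color h x == color h y then w + w else w) 1 H.

Definition cost H h x c :=
  foldl (fun s (e : nat * nat) => if e.2 == c then s + weight H x e.1 else s) 0 h.

(** In the application the initial candidate 0 is itself one of the colours. *)
Definition best H h x :=
  foldl (fun bc c => if cost H h x c < bc.2 then (c, cost H h x c) else bc)
    (0, cost H h x 0) colors.

Definition new_hash H := foldl (fun h x => (x, (best H h x).1) :: h) [::] vs.

Definition add_hash H := new_hash H :: H.

Lemma weightE H x y :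
  weight H x y = 2 ^ count (fun h => color h x == color h y) H.
Proof.
rewrite /weight -[RHS]mul1n; move: {1 2}1 => w.
elim: H w => [|h H IH] w /=; first by rewrite muln1.
by rewrite IH; case: eqP => _ //; rewrite add1n expnS mulnA muln2 addnn.
Qed.

Lemma costE H h x c : cost H h x c = \sum_(e <- h | e.2 == c) weight H x e.1.
Proof.
have H0 s : foldl (fun s e => if e.2 == c then s + weight H x e.1 else s) s h =
            s + \sum_(e <- h | e.2 == c) weight H x e.1.
  elim: h s => [|e h IH] s /=; first by rewrite big_nil addn0.
  by rewrite IH big_cons; case: ifP; rewrite ?addnA.
exact: H0.
Qed.

Lemma bestP H h x :
  [/\ cost H h x (best H h x).1 = (best H h x).2,
      {in colors, forall c, (best H h x).2 <= cost H h x c}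
    & (best H h x).1 \in 0 :: colors].
Proof.
rewrite /best; elim/last_ind: colors => [|s c [IH1 IH2 IH3]] /=.
  by rewrite mem_head.
rewrite foldl_rcons; set b := foldl _ _ s in IH1 IH2 IH3 *.
case: ltnP => lt /=; split=> //.
- move=> d; rewrite mem_rcons inE => /orP[/eqP ->|/IH2 le] //.
  exact: leq_trans (ltnW lt) le.
- by rewrite inE mem_rcons mem_head orbT.
- by move=> d; rewrite mem_rcons inE => /orP[/eqP ->|/IH2].
- by move: IH3; rewrite !inE mem_rcons inE => /orP[->|->]; rewrite ?orbT.
Qed.

(** The costs of all colours add up to at most the whole weight between [x] and the vertices
    coloured so far, and the cheapest is at most the average. *)
Lemma best_avg H h x : uniq colors ->
  size colors * (best H h x).2 <= \sum_(e <- h) weight H x e.1.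
Proof.
move=> uc; have [_ le _] := bestP H h x.
rewrite -sum1_size big_distrl /=.
apply: (@leq_trans (\sum_(c <- colors) cost H h x c)).
  by rewrite big_seq [leqRHS]big_seq; apply: leq_sum => c /le; rewrite mul1n.
under eq_bigr => c _ do rewrite costE big_mkcond.
rewrite exchange_big /=; apply: leq_sum => e _.
rewrite -big_mkcond /= -big_filter.
case E: (e.2 \in colors).
  rewrite (_ : filter _ _ = [:: e.2]) ?big_seq1 //.
  by rewrite (eq_filter (a2 := pred1 e.2)) ?filter_pred1_uniq // => c; rewrite /= eq_sym.
rewrite (_ : filter _ _ = [::]) ?big_nil //.
apply/eqP; rewrite -[_ == _]negbK -has_filter; apply/hasPn => c cc.
by apply: contraFneq E => ->.
Qed.

Fixpoint pairsum (E : Type) (f : E -> E -> nat) (s : seq E) : nat :=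
  if s is x :: s' then \sum_(y <- s') f x y + pairsum f s' else 0.

Lemma pairsum_map (E E' : Type) (g : E -> E') f s :
  pairsum f (map g s) = pairsum (fun x y => f (g x) (g y)) s.
Proof. by elim: s => //= x s ->; rewrite big_map. Qed.

Lemma eq_in_pairsum (E : eqType) (f f' : E -> E -> nat) s :
  {in s &, f =2 f'} -> pairsum f s = pairsum f' s.
Proof.
elim: s => //= x s IH eqf; congr (_ + _).
  apply: eq_big_seq => y ys; apply: eqf; by rewrite inE ?eqxx ?ys ?orbT.
by apply: IH => y z ys zs; apply: eqf; rewrite inE ?ys ?zs orbT.
Qed.

Lemma pairsumD E (f f' : E -> E -> nat) s :
  pairsum (fun x y => f x y + f' x y) s = pairsum f s + pairsum f' s.
Proof. by elim: s => //= x s ->; rewrite big_split /=; lia. Qed.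

Lemma pairsum1 E (s : seq E) : pairsum (fun _ _ => 1) s <= size s ^ 2.
Proof. by elim: s => //= x s; rewrite sum1_size; nia. Qed.

Lemma leq_pairsum (E : eqType) (f : E -> E -> nat) s x y :
  (forall x y, f x y = f y x) -> x \in s -> y \in s -> x != y ->
  f x y <= pairsum f s.
Proof.
move=> fC; have le z t u : z \in t -> f u z <= \sum_(y <- t) f u y.
  by move=> zt; rewrite (big_rem z) //= leq_addr.
elim: s => //= z s IH; rewrite !inE => /orP[/eqP ->|xs] /orP[/eqP ->|ys] xy.
- by rewrite eqxx in xy.
- exact: leq_trans (le _ _ _ ys) (leq_addr _ _).
- by rewrite fC; apply: leq_trans (le _ _ _ xs) (leq_addr _ _).
- exact: leq_trans (IH xs ys xy) (leq_addl _ _).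
Qed.

Lemma unzip1_new_hash H : unzip1 (new_hash H) = rev vs.
Proof.
rewrite /new_hash -[vs]revK foldl_rev revK.
by elim: (rev vs) => //= x s ->.
Qed.

Lemma color_mem h e : uniq (unzip1 h) -> e \in h -> color h e.1 = e.2.
Proof.
move=> uh eh; rewrite /color.
have : e.1 \in unzip1 h by apply: map_f.
rewrite -isSome_lookup; case E: lookup => [f|] // _.
have [fh fe] := lookup_some E.
elim: h uh eh fh {E} => //= g h IH /andP[ng uh]; rewrite !inE.
case/orP => [/eqP eg|eh] /orP[/eqP fg|fh]; last exact: IH.
- by rewrite eg fg.
- by move: ng; rewrite -eg -fe (map_f fst fh).
- by move: ng; rewrite -fg fe (map_f fst eh).
Qed.

Lemma color_new_hash H x : color (new_hash H) x \in 0 :: colors.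
Proof.
have : all (fun e => e.2 \in 0 :: colors) (new_hash H).
  rewrite /new_hash -[vs]revK foldl_rev; elim: (rev vs) => //= y s ->.
  by rewrite andbT; set g := foldr _ _ s; case: (bestP H g y).
move/allP => al; rewrite /color; case E: lookup => [e|]; last exact: mem_head.
by apply: al; case: (lookup_some E).
Qed.

Definition potential H := pairsum (weight H) (rev vs).

(** The new potential is the old one plus the weight of the pairs that collide under the new
    function. A vertex adds, when it is coloured, at most a fraction [1 / q] of its weight to the
    vertices coloured before, in total [1 / q] of the old potential. *)
Lemma potential_step H : uniq colors -> uniq vs ->
  size colors * potential (add_hash H) <= (size colors).+1 * potential H.
Proof.
move=> uc uv; rewrite /potential /add_hash -(unzip1_new_hash H).
set h := new_hash H.
have -> : pairsum (weight (h :: H)) (unzip1 h) =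
  pairsum (weight H) (unzip1 h) +
  pairsum (fun e e' : nat * nat => if e.2 == e'.2 then weight H e.1 e'.1 else 0) h.
  rewrite !pairsum_map -pairsumD; apply: eq_in_pairsum => e e' eh eh'.
  have uh : uniq (unzip1 h) by rewrite unzip1_new_hash rev_uniq.
  rewrite !weightE /= !(color_mem uh) //.
  by case: eqP => _; rewrite ?addn0 //= expnS; lia.
rewrite mulnDr mulSn addnC leq_add2r pairsum_map /h /new_hash.
rewrite -[vs]revK foldl_rev; elim: (rev vs) => [|x s IH] /=; first by rewrite muln0.
rewrite mulnDr; apply: leq_add => //; set g := foldr _ _ s.
have [bc _ _] := bestP H g x.
apply: leq_trans (best_avg H g x uc); rewrite -bc costE.
rewrite leq_mul2l -big_mkcond /=; apply/orP; right.
by rewrite (eq_bigl (fun e => e.2 == (best H g x).1)) // => e; rewrite eq_sym.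
Qed.

Lemma potential_iter L : uniq colors -> uniq vs ->
  size colors ^ L * potential (iter L add_hash [::]) <=
  (size colors).+1 ^ L * size vs ^ 2.
Proof.
move=> uc uv; elim: L => [|L IH].
  by rewrite !mul1n -[size vs]size_rev; apply: pairsum1.
rewrite iterS [in leqLHS]expnS [_.+1 ^ L.+1]expnS; set Phi := potential (iter _ _ _) in IH.
apply: (@leq_trans (size colors ^ L * ((size colors).+1 * Phi))).
  by rewrite [size colors * _]mulnC -mulnA leq_mul2l potential_step ?orbT.
by rewrite mulnCA -(mulnA (size colors).+1); apply: leq_mul.
Qed.

(** Bernoulli's inequality (1 - 1/(q+1))^r >= 1 - r/(q+1), cleared of denominators. *)
Lemma bernoulli q r : r <= q.+1 -> q.+1 ^ r * (q.+1 - r) <= q ^ r * q.+1.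
Proof.
elim: r => [|r IH] lt; first by rewrite subn0.
apply: leq_trans (_ : q * (q.+1 ^ r * (q.+1 - r)) <= _); last first.
  by rewrite expnS -mulnA leq_mul2l IH ?orbT // ltnW.
rewrite expnS -mulnA mulnCA [leqRHS]mulnCA leq_mul2l.
by apply/orP; right; nia.
Qed.

(** For [2 * r <= q] the factor 1 - r/(q+1) is at least one half. *)
Lemma expS_double q r : 0 < q -> 2 * r <= q -> q.+1 ^ r <= 2 * q ^ r.
Proof.
move=> q0 le; have := @bernoulli q r ltac:(lia) => B.
have : q.+1 ^ r * q.+1 <= 2 * q ^ r * q.+1.
  apply: leq_trans (_ : 2 * (q.+1 ^ r * (q.+1 - r)) <= _); last by lia.
  by rewrite mulnCA leq_mul2l; apply/orP; right; lia.
by rewrite leq_mul2r.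
Qed.

(** Since [4 * M <= size colors], a block of [2 * M] functions at most doubles the potential, which
    therefore ends at no more than [2 ^ l * size vs ^ 2]. The weight of a single pair is 2 to its
    number of collisions, so this number is at most [l + 2 * l0 = 2 * l - 1]. *)
Lemma collisions_le M l0 l x y : uniq colors -> uniq vs -> 0 < M ->
  4 * M <= size colors -> size vs <= 2 ^ l0 -> l = 2 * l0 + 1 ->
  x \in vs -> y \in vs -> x != y ->
  count (fun h => color h x == color h y) (iter (2 * M * l) add_hash [::]) < 2 * l.
Proof.
move=> uc uv M0 qM nl el xv yv xy; set H := iter _ _ _; set q := size colors in qM.
suff : 2 ^ count (fun h => color h x == color h y) H <= 2 ^ (l + 2 * l0).
  by rewrite leq_exp2l //; lia.
have wC a b : weight H a b = weight H b a.
  by rewrite !weightE; congr (_ ^ _); apply: eq_count => h; rewrite eq_sym.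
rewrite -weightE; apply: leq_trans (_ : potential H <= _).
  by apply: leq_pairsum; rewrite ?mem_rev.
have q0 : 0 < q by lia.
have := potential_iter (2 * M * l) uc uv; rewrite -/H -/q => le.
have : q ^ (2 * M * l) * potential H <= q ^ (2 * M * l) * 2 ^ (l + 2 * l0).
  apply: leq_trans le _; rewrite expnM [q ^ _]expnM expnD mulnA.
  apply: leq_mul; last by rewrite mulnC expnM leq_exp2r.
  rewrite -expnMn leq_exp2r; last by lia.
  by rewrite [leqRHS]mulnC; apply: expS_double => //; lia.
by rewrite leq_pmul2l // expn_gt0 q0.
Qed.

(** Union bound: each of at most [M] pairs spoils at most [2 * l - 1] of the [2 * M * l]
    functions. *)
Lemma separating_hash M l0 l (X Y : seq nat) : uniq colors -> uniq vs -> 0 < M ->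
  4 * M <= size colors -> size vs <= 2 ^ l0 -> l = 2 * l0 + 1 ->
  {subset X <= vs} -> {subset Y <= vs} -> ~~ has (mem X) Y ->
  size X * size Y <= M ->
  exists2 h, h \in iter (2 * M * l) add_hash [::] &
    {in X & Y, forall x y, color h x != color h y}.
Proof.
move=> uc uv M0 qM nl el sX sY dis le; set H := iter _ _ _.
pose bad h := has (fun x => has (fun y => color h x == color h y) Y) X.
have szH : size H = 2 * M * l by rewrite /H; elim: (2 * M * l) => //= L ->.
have [/hasP[h hH nbad]|] := boolP (has (predC bad) H).
  exists h => // x y xX yY; apply: contra nbad => c; rewrite /= /bad.
  by apply/hasP; exists x => //; apply/hasP; exists y.
rewrite has_predC negbK all_count szH => /eqP cH.
suff : count bad H <= M * (2 * l - 1) by nia.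
apply: leq_trans (_ : \sum_(x <- X) \sum_(y <- Y)
    count (fun h => color h x == color h y) H <= _); last first.
  apply: leq_trans (_ : \sum_(x <- X) \sum_(y <- Y) (2 * l - 1) <= _).
    rewrite big_seq [leqRHS]big_seq; apply: leq_sum => x xX.
    rewrite big_seq [leqRHS]big_seq; apply: leq_sum => y yY.
    have xy : x != y by apply: contraNneq dis => xy; apply/hasP; exists y; rewrite //= -xy.
    by have := collisions_le uc uv M0 qM nl el (sX _ xX) (sY _ yY) xy; rewrite -/H; lia.
  by rewrite !big_const_seq !count_predT !iter_addn_0 -mulnA mulnC leq_mul2r
    [size Y * _]mulnC le orbT.
elim: H {szH cH} => [|h H IH] /=; first by [].
under eq_bigr => x _ do rewrite big_split /=.
rewrite big_split /=; apply: leq_add => //.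
rewrite /bad; case: hasP => [[x xX /hasP[y yY c]]|] //=.
by rewrite (big_rem x) //= (big_rem y) //= c.
Qed.

End GreedyHashing.

(** * Networks and tuples *)

Lemma foldl_const (S E : Type) (f : S -> S) (s : seq E) x :
  foldl (fun a _ => f a) x s = iter (size s) f x.
Proof. by elim: s x => //= _ s IH x; rewrite IH -iterSr. Qed.

(** The order in which the program produces a range, by repeatedly subtracting 1. *)
Definition down n := rev (iota 0 n).

Lemma size_down n : size (down n) = n.
Proof. by rewrite size_rev size_iota. Qed.

Lemma mem_down n x : (x \in down n) = (x < n).
Proof. by rewrite mem_rev mem_iota. Qed.

Lemma downS n : down n.+1 = n :: down n.
Proof. by rewrite /down -addn1 iotaD rev_cat. Qed.

Lemma foldl_cons (S E : Type) (g : E -> S) s acc :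
  foldl (fun acc x => g x :: acc) acc s = rev (map g s) ++ acc.
Proof.
elim: s acc => //= x s IH acc.
by rewrite IH rev_cons cat_rcons.
Qed.

Section Network.
Variables (cnt U : seq nat) (n : nat).

(** [cnt] is a counter in unary; only its length matters. *)
Definition repeat_cons (T : Type) (a : T) (l : seq T) :=
  foldl (fun l _ => a :: l) l cnt.

Definition row_arcs (x : nat) (row : seq nat) (l : seq darc) :=
  foldl (fun l w => repeat_cons (x, w) l) l row.

Definition vertex_arcs (ul : nat * seq darc) (row : seq nat) :=
  (ul.1.+1,
   row_arcs (n + ul.1) row
     (if ul.1 \in U then repeat_cons (ul.1, n + ul.1) ul.2
      else (ul.1, n + ul.1) :: ul.2)).

Definition network (adj : seq (seq nat)) := (foldl vertex_arcs (0, [::]) adj).2.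

Lemma count_repeat_cons T (p : pred T) a l :
  count p (repeat_cons a l) = size cnt * p a + count p l.
Proof.
rewrite /repeat_cons foldl_const; elim: (size cnt) => //= c ->.
by rewrite mulSn; lia.
Qed.

Lemma count_row_arcs p x row l :
  count p (row_arcs x row l) = size cnt * count (fun w => p (x, w)) row + count p l.
Proof.
rewrite /row_arcs; elim: row l => [|w row IH] l /=; first by rewrite muln0.
by rewrite IH count_repeat_cons mulnDr; lia.
Qed.

(** With an arbitrary predicate this one count gives membership, multiplicities and the size of the
    network. *)
Lemma count_network p adj : count p (network adj) =
  \sum_(i < size adj)
    ((if (i : nat) \in U then size cnt else 1) * p (i : nat, n + i) +
     size cnt * count (fun w => p (n + i, w)) (nth [::] adj i)).
Proof.
suff gen u l : count p (foldl vertex_arcs (u, l) adj).2 = count p l +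
  \sum_(i < size adj)
    ((if u + i \in U then size cnt else 1) * p (u + i, n + (u + i)) +
     size cnt * count (fun w => p (n + (u + i), w)) (nth [::] adj i)) by exact: gen.
elim: adj u l => [|row adj IH] u l /=; first by rewrite big_ord0 addn0.
rewrite IH big_ord_recl /= addn0 count_row_arcs.
have -> : count p (if u \in U then repeat_cons (u, n + u) l else (u, n + u) :: l) =
  (if u \in U then size cnt else 1) * p (u, n + u) + count p l.
  by case: ifP => _; rewrite ?count_repeat_cons //= mul1n.
rewrite [in RHS](eq_bigr (fun i : 'I_(size adj) =>
  (if u.+1 + i \in U then size cnt else 1) * p (u.+1 + i, n + (u.+1 + i)) +
     size cnt * count (fun w => p (n + (u.+1 + i), w)) (nth [::] adj i))); last first.
  by move=> i _; rewrite /= /bump add1n add0n !addSnnS.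
move: (size cnt * _) (_ * nat_of_bool _) (count p l) (\sum_(i < _) _).
by clear=> *; lia.
Qed.

End Network.

Definition targets_init (Ts : seq nat) : seq (nat * seq darc) :=
  foldl (fun B t => (t, [::]) :: B) [::] Ts.

Lemma targets_initE Ts : targets_init Ts = [seq (t, [::]) | t <- rev Ts].
Proof. by rewrite /targets_init foldl_cons cats0 map_rev. Qed.

Definition vals n (A : {set 'I_n}) : seq nat := [seq nat_of_ord u | u <- enum A].

Lemma mem_vals n (A : {set 'I_n}) (u : 'I_n) : ((u : nat) \in vals A) = (u \in A).
Proof. by rewrite mem_map ?mem_enum //; apply: val_inj. Qed.

Definition adjacency (G : digraph) : seq (seq nat) :=
  [seq vals [set v | edge u v] | u <- enum (vertex G)].

Section GraphNetwork.
Variables (G : digraph) (T : {set vertex G}) (k : nat).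
Notation n := (nb_vertices G).
Let net := network (down k.+1) (vals (undeletable G)) n (adjacency G).

Lemma count_graph_network (p : pred darc) : count p net =
  \sum_(u < n) ((if u \in undeletable G then k.+1 else 1) * p (u : nat, n + u) +
     k.+1 * count (fun w => p (n + u, w)) (vals [set v | edge u v])).
Proof.
rewrite count_network size_down.
have sz : size (adjacency G) = n by rewrite size_map size_enum_ord.
rewrite sz; apply: eq_bigr => u _; rewrite mem_vals; congr (_ + _ * count _ _).
by rewrite (nth_map u) ?size_enum_ord // nth_ord_enum.
Qed.

Lemma count_graph_network_ge (p : pred darc) (u : vertex G) :
  (if u \in undeletable G then k.+1 else 1) * p (u : nat, n + u) +
     k.+1 * count (fun w => p (n + u, w)) (vals [set v | edge u v]) <= count p net.
Proof. by rewrite count_graph_network (bigD1 u) //= leq_addr. Qed.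

Lemma net_arcsP a : a \in net ->
  (exists u w : vertex G, edge u w /\ a = (n + u, w : nat)) \/
  (exists u : vertex G, a = (u : nat, n + u)).
Proof.
rewrite -has_pred1 has_count count_graph_network lt0n sum_nat_eq0.
case/forallPn => u /=; rewrite addn_eq0 negb_and !muln_eq0 !negb_or.
case/orP => /andP[_].
  by rewrite eqb0 negbK => /eqP <-; right; exists u.
rewrite -lt0n -has_count => /hasP[w /mapP[v + ->] /eqP <-].
by rewrite mem_enum inE => euv; left; exists u, v.
Qed.

Lemma net_edge (u w : vertex G) : edge u w -> k < count_mem (n + u, w : nat) net.
Proof.
move=> euw; apply: leq_trans (count_graph_network_ge _ u).
apply: leq_trans (leq_addl _ _); rewrite leq_pmulr // -has_count.
by apply/hasP; exists (w : nat); rewrite ?mem_vals ?inE //= eqxx.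
Qed.

Lemma net_undel (u : vertex G) : u \in undeletable G ->
  k < count_mem (u : nat, n + u) net.
Proof.
move=> uU; apply: leq_trans (count_graph_network_ge _ u).
by apply: leq_trans (leq_addr _ _); rewrite uU /= eqxx muln1.
Qed.

Lemma net_vertex (u : vertex G) : (u : nat, n + u) \in net.
Proof.
rewrite -has_pred1 has_count; apply: leq_trans (count_graph_network_ge _ u).
by apply: leq_trans (leq_addr _ _); rewrite /= eqxx muln1; case: ifP.
Qed.

Lemma net_del (u : vertex G) : u \notin undeletable G ->
  count (fun a : darc => a.1 == u) net = 1.
Proof.
move=> uU; rewrite count_graph_network (bigD1 u) //= (negPf uU) eqxx.
have z (w : vertex G) l : count (fun _ : nat => n + w == u) l = 0.
  rewrite (eq_count (a2 := pred0)) ?count_pred0 // => x /=.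
  by apply/eqP => e; have := ltn_ord u; lia.
rewrite z muln0 big1 ?addn0 // => w wu.
by rewrite z muln0 addn0 (_ : (w == u :> nat) = false) ?muln0 //; apply: negPf.
Qed.

Lemma size_net : size net <= (k.+1 * (n + n * n)).
Proof.
rewrite -(count_predT net) count_graph_network /=.
apply: leq_trans (_ : \sum_(u < n) (k.+1 * n.+1) <= _); last first.
  by rewrite big_const_ord iter_addn_0; nia.
apply: leq_sum => u _; rewrite count_predT size_map -cardE muln1.
rewrite mulnS; apply: leq_add; first by case: ifP.
by rewrite leq_mul2l -[X in _ <= X]card_ord max_card orbT.
Qed.

Lemma targets_init_nil e : e \in targets_init (vals T) -> e.2 = [::].
Proof. by rewrite targets_initE => /mapP[t _ ->]. Qed.

Lemma targets_initP (x : nat) :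
  reflect (exists2 t : vertex G, t \in T & x = t :> nat)
    (x \in unzip1 (targets_init (vals T))).
Proof.
rewrite targets_initE /unzip1 -map_comp map_id mem_rev.
apply: (iffP mapP) => -[t]; first by rewrite mem_enum => tT ->; exists t.
by move=> tT ->; exists t; rewrite ?mem_enum.
Qed.

End GraphNetwork.

(** * Tuples of colours *)

Section Tuples.
Variable colors : seq nat.

Definition extend_tuples (ts : seq (seq nat)) :=
  foldl (fun acc t => foldl (fun acc c => (c :: t) :: acc) acc colors) [::] ts.

Lemma extend_tuplesE ts : extend_tuples ts =
  foldl (fun acc t => rev [seq c :: t | c <- colors] ++ acc) [::] ts.
Proof.
rewrite /extend_tuples; elim: ts [::] => //= t ts IH acc.
by rewrite IH (foldl_cons (fun c => c :: t)).
Qed.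

Lemma size_extend_tuples ts : size (extend_tuples ts) = size ts * size colors.
Proof.
rewrite extend_tuplesE; elim/last_ind: ts => // ts t IH.
by rewrite foldl_rcons size_cat size_rev size_map IH size_rcons mulSn.
Qed.

Lemma mem_extend_tuples c t ts : c \in colors -> t \in ts ->
  c :: t \in extend_tuples ts.
Proof.
move=> cC; rewrite extend_tuplesE; elim/last_ind: ts => // ts u IH.
rewrite foldl_rcons mem_cat mem_rcons inE => /orP[/eqP ->|/IH ->]; last by rewrite orbT.
by rewrite mem_rev map_f.
Qed.

Definition tuples k := iter k extend_tuples [:: [::]].

Lemma size_tuples k : size (tuples k) = size colors ^ k.
Proof. by elim: k => //= k IH; rewrite size_extend_tuples IH expnSr. Qed.

Lemma mem_tuples k t : size t = k -> {subset t <= colors} -> t \in tuples k.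
Proof.
elim: k t => [|k IH] [|c t] //= [sz] sub; apply: mem_extend_tuples.
  by apply: sub; rewrite mem_head.
by apply: IH => // x xt; apply: sub; rewrite inE xt orbT.
Qed.

End Tuples.

(** A unary counter of length [2 * l0 + 1], where [l0] is the number of doublings that take [p] to
    at least [n]. This is the [l] of the hashing bound, computed without division. *)
Fixpoint log_list fuel n p : seq nat :=
  if fuel is f.+1 then
    if p < n then 0 :: 0 :: log_list f n (p + p) else [:: 0]
  else [:: 0].

Lemma log_listP fuel n p : 0 < p -> n <= p + fuel -> exists l0,
  [/\ size (log_list fuel n p) = 2 * l0 + 1, n <= p * 2 ^ l0
    & l0 = 0 \/ p * 2 ^ l0.-1 < n].
Proof.
elim: fuel p => [|f IH] p p0 le /=; first by exists 0; split; [|lia|left].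
case: ltnP => lt; last by exists 0; split; [|lia|left].
have [||l0 [sz H1 H2]] := IH (p + p); try lia.
exists l0.+1; rewrite /= sz; split; first by lia.
  by rewrite expnS; lia.
by right; case: H2 => [->|]; [lia|case: l0 {sz H1} => [|l]; rewrite /= ?expnS; lia].
Qed.

(** * Vertex sets determined by a colouring and a tuple *)

Section Sets.
Implicit Types (h : seq (nat * nat)) (t : seq nat).

Definition all_colored h t (D : seq nat) : bool :=
  foldl (fun b x => if color h x \in t then b else false) true D.

Definition some_colored h t (L : seq (seq nat)) : bool :=
  foldl (fun b D => if all_colored h t D then true else b) false L.

Definition shadow_set (LL : seq (nat * seq (seq nat))) h t : seq nat :=
  foldl (fun acc vL => if some_colored h t vL.2 then vL.1 :: acc else acc) [::] LL.

Definition shadow_sets LL ts acc h : seq (seq nat) :=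
  foldl (fun acc t => shadow_set LL h t :: acc) acc ts.

Lemma all_coloredE h t D : all_colored h t D = all (fun x => color h x \in t) D.
Proof.
rewrite /all_colored; elim/last_ind: D => // D x IH.
by rewrite foldl_rcons all_rcons IH; case: ifP.
Qed.

Lemma some_coloredE h t L : some_colored h t L = has (all_colored h t) L.
Proof.
rewrite /some_colored; elim/last_ind: L => // L D IH.
by rewrite foldl_rcons has_rcons IH; case: ifP.
Qed.

Lemma shadow_setE LL h t :
  shadow_set LL h t = [seq vL.1 | vL <- rev LL & some_colored h t vL.2].
Proof.
rewrite /shadow_set -[LL]revK foldl_rev revK; elim: (rev LL) => //= vL s ->.
by case: ifP.
Qed.

Lemma size_shadow_sets LL ts acc h :
  size (shadow_sets LL ts acc h) = size ts + size acc.
Proof. by rewrite /shadow_sets foldl_cons size_cat size_rev size_map. Qed.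

Lemma mem_shadow_sets LL ts acc h z :
  (z \in shadow_sets LL ts acc h) =
  (z \in acc) || (z \in [seq shadow_set LL h t | t <- ts]).
Proof.
by rewrite /shadow_sets foldl_cons mem_cat mem_rev orbC.
Qed.

End Sets.

(** * The covering family *)

Definition separator_lists B0 k n A (Ts vs : seq nat) :=
  foldl (fun acc v => if v \in Ts then acc else
           (v, tree B0 k (k + k).+1 A [::] [:: v; n + v] [::]) :: acc) [::] vs.

Lemma separator_listsE B0 k n A Ts vs :
  separator_lists B0 k n A Ts vs =
  rev [seq (v, tree B0 k (k + k).+1 A [::] [:: v; n + v] [::]) |
       v <- vs & v \notin Ts].
Proof.
rewrite /separator_lists; elim/last_ind: vs => // vs v IH.
rewrite foldl_rcons IH filter_rcons; case: ifP => //= _.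
by rewrite map_rcons rev_rcons.
Qed.

Definition hash_family colors vs (ls rs : seq nat) :=
  foldl (fun H _ => foldl (fun H _ => add_hash colors vs H) H ls) [::] rs.

Lemma hash_familyE colors vs ls rs :
  hash_family colors vs ls rs = iter (size rs * size ls) (add_hash colors vs) [::].
Proof.
rewrite /hash_family foldl_const; elim: (size rs) => //= r ->.
by rewrite foldl_const mulSn iterD.
Qed.

Section Output.
Variables (G : digraph) (T : {set vertex G}) (k : nat).
Notation n := (nb_vertices G).

Let net := network (down k.+1) (vals (undeletable G)) n (adjacency G).
Let B0 := targets_init (vals T).
Let colors := down (2 ^ (4 * k + 3)).
Let LL := separator_lists B0 k n net (vals T) (iota 0 n).
Let ls := log_list n n 1.
Let H := hash_family colors (down n) ls (down (2 ^ (4 * k + 2))).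

Definition output : seq (seq nat) :=
  foldl (shadow_sets LL (tuples colors k)) [:: [::]] H.

Lemma mem_output z : (z \in output) = (z == [::]) ||
  has (fun h => z \in [seq shadow_set LL h t | t <- tuples colors k]) H.
Proof.
rewrite /output; elim/last_ind: (H) => [|s h IH]; first by rewrite inE orbF.
by rewrite foldl_rcons has_rcons mem_shadow_sets IH -orbA [X in _ || X]orbC.
Qed.

Let sep_list v := tree B0 k (k + k).+1 net [::] [:: v; n + v] [::].

(** Both lists are built by prepending, so the two reversals cancel and the vertices come out
    increasing, the order in which [enc_set] lists them. *)
Lemma shadow_set_output h t :
  shadow_set LL h t =
  [seq v <- iota 0 n | (v \notin vals T) && some_colored h t (sep_list v)].
Proof.
rewrite shadow_setE /LL separator_listsE revK filter_map -map_comp map_id.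
by rewrite -filter_predI; apply: eq_filter => v /=; rewrite andbC.
Qed.

Lemma filter_vals (p : pred nat) :
  [seq v <- iota 0 n | p v] = vals [set u : vertex G | p u].
Proof.
rewrite -(val_enum_ord n) filter_map /vals; congr map.
rewrite /enum_mem -filter_predI; apply: eq_filter => u.
by rewrite /= [RHS](in_set (fun u : vertex G => p u)) andbT.
Qed.

Lemma output_sets z : z \in output ->
  z = vals (vset G z) /\ vset G z \subset ~: T.
Proof.
have valsK (A : {set vertex G}) : vset G (vals A) = A.
  by apply/setP => u; rewrite inE mem_vals.
rewrite mem_output => /orP[/eqP ->|/hasP[h _ /mapP[t _ ->]]].
  have -> : vset G [::] = set0 by apply/setP => u; rewrite !inE.
  by rewrite /vals enum_set0 sub0set.
rewrite shadow_set_output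
  (filter_vals (fun v => (v \notin vals T) && some_colored h t (sep_list v))).
rewrite valsK; split=> //; apply/subsetP => u; rewrite !inE mem_vals.
by case/andP.
Qed.

(** [l0] is the logarithm rounded up, at most [trunc_log 2 n + 1]; since [log2] is at least 1, a
    factor 2 absorbs the rounding. *)
Lemma size_ls : exists l0,
  [/\ size ls = 2 * l0 + 1, n <= 2 ^ l0 & l0 <= 2 * log2 n].
Proof.
have [||l0 [sz H1 H2]] := @log_listP n n 1; [by []|by lia|].
exists l0; split=> //; first by rewrite mul1n in H1.
case: H2 => [->//|]; rewrite mul1n => lt.
have : l0.-1 <= trunc_log 2 n by apply: trunc_log_max => //; apply: ltnW.
by rewrite /log2; lia.
Qed.

Lemma size_output :
  size output <= 2 ^ (4 * k ^ 2 + 7 * k + 5) * log2 n.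
Proof.
have -> : size output = size H * size (tuples colors k) + 1.
  rewrite /output; elim/last_ind: (H) => [|s h IH]; first by [].
  by rewrite foldl_rcons size_shadow_sets IH size_rcons mulSn addnA.
have [l0 [sz _ le]] := size_ls.
have szH : size H = 2 ^ (4 * k + 2) * size ls.
  rewrite /H hash_familyE size_down.
  by elim: (_ * _) => //= L ->.
rewrite szH size_tuples size_down -expnM sz mulnAC -expnD.
have -> : 4 * k + 2 + (4 * k + 3) * k = 4 * k ^ 2 + 7 * k + 2 by rewrite -mulnn; lia.
(* The remaining factor [2 * l0 + 1] is at most [5 * log2 n]; together with the additional empty set
   it fits into [2 ^ 3 * log2 n]. *)
rewrite -[5]/(2 + 3) addnA (expnD _ _ 3) -mulnA.
have : 0 < 2 ^ (4 * k ^ 2 + 7 * k + 2) by rewrite expn_gt0.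
have : 1 <= log2 n by rewrite /log2; lia.
by move: (2 ^ _) (log2 n) le; clear=> x l le l1 x1; nia.
Qed.

Lemma separator_mono (A C W W' : {set vertex G}) : W \subset W' ->
  W' \subset ~: (A :|: C :|: undeletable G) -> separator A C W -> separator A C W'.
Proof.
move=> /subsetP WW' sub /and5P[A0 C0 dis _ /forall_inP sep].
apply/and5P; split=> //; apply/forall_inP => a aA; apply/forall_inP => c cC.
have /forall_inP/(_ c cC) := sep a aA; apply: contra; apply: connect_sub => x y.
rewrite /edge_minus /= => /and3P[exy xW yW]; apply: connect1.
by rewrite /edge_minus /= exy !(contra (WW' _)).
Qed.

Lemma sep_list_sound (v : vertex G) D : T != set0 -> v \notin T -> D \in sep_list v ->
  valid T v D /\ separator [set v] T (vset G D).
Proof.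
move=> T0 vT DL.
have := @tree_sound G T k net B0 (@targets_init_nil _ T) (@targets_initP _ T)
  (@net_arcsP G k) (@net_edge G k) (@net_undel G k) (@net_del G k) (@net_vertex G k)
  v (k + k).+1 net [::] [:: v : nat; n + v] [::] D T0 vT.
case=> //; rewrite ?inE ?eqxx ?orbT //.
by rewrite /minus filter_predT.
Qed.

Lemma sep_list_complete (v : vertex G) S : important_separator [set v] T S ->
  #|S| <= k -> exists2 D, D \in sep_list v & vset G D = S.
Proof.
move=> imp Sk.
have RS := @RS_source G T net B0 (@targets_init_nil _ T) (@targets_initP _ T)
  (@net_arcsP G k) _ _ imp.
have := @tree_complete G T k net B0 (@targets_init_nil _ T) (@targets_initP _ T)
  (@net_arcsP G k) (@net_edge G k) (@net_undel G k) (@net_del G k) (@net_vertex G k)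
  v S imp (k + k).+1 net [::] [:: v : nat; n + v] [::] k 0.
apply=> //.
- by rewrite /minus filter_predT.
- by rewrite addn0.
- by case: RS => /= -> ->.
- by rewrite mem_head.
- by rewrite !inE eqxx orbT.
- by rewrite addn0 -addnn.
Qed.

Lemma size_sep_list v : size (sep_list v) <= 2 ^ (2 * k + 1).
Proof. by apply: leq_trans (size_tree _ _ _ _ _ _ _) _; rewrite addn0 addnn -mul2n addn1. Qed.

Lemma mem_iter_hash cs vs L h : h \in iter L (add_hash cs vs) [::] ->
  exists H', h = new_hash cs vs H'.
Proof.
by elim: L => //= L IH; rewrite inE => /orP[/eqP ->|/IH //]; eexists.
Qed.

(** * Covering a thin set and its companion *)

Section Cover.
Variables W Y : {set vertex G}.
Hypothesis subW : W \subset ~: (T :|: undeletable G).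
Hypothesis thinW : thin T W.
Hypothesis cardW : #|W| <= k.
Hypothesis impY : forall v, v \in Y ->
  exists W' : {set vertex G}, W' \subset W /\ important_separator [set v] T W'.

Let out_of_W (D : seq nat) := head 0 [seq x <- D | x \notin vals W].
Let forbidden := flatten [seq [seq out_of_W D | D <- sep_list w] | w <- vals W].

(** A listed [D] never contains [w]. If it were inside [W], then [W] without [w] would contain a
    separator and be one itself, against thinness; so the default of [head] does not occur. *)
Lemma out_of_WP w D : T != set0 -> w \in W -> D \in sep_list w ->
  [/\ out_of_W D \in D, out_of_W D \notin vals W & out_of_W D < n].
Proof.
move=> T0 wW DL.
have wTU : w \notin T :|: undeletable G by move/subsetP/(_ _ wW): subW; rewrite inE.
have wT : w \notin T by apply: contra wTU => wT; rewrite inE wT.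
have [vD sepD] := sep_list_sound T0 wT DL.
suff : out_of_W D \in [seq x <- D | x \notin vals W].
  rewrite mem_filter => /andP[oW oD]; split=> //.
  by have [u [-> _ _ _]] := vD _ oD.
rewrite /out_of_W; case E: [seq x <- D | _] => [|x s]; last exact: mem_head.
have DW : {subset D <= vals W}.
  move=> x xD; apply: contraT => xW.
  suff : x \in [seq x <- D | x \notin vals W] by rewrite E.
  by rewrite mem_filter xW.
have := thinW wW; rewrite inE => /negP[].
apply: separator_mono sepD; apply/subsetP => u.
  rewrite !inE => uD; have := DW _ uD; rewrite mem_vals => ->; rewrite andbT.
  by have [x [/val_inj <- _ _]] := vD _ uD.
rewrite !inE => /andP[uw uW]; have := subsetP subW _ uW; rewrite !inE.
by rewrite (negPf uw).
Qed.

(** Two factors [k], each at most [2 ^ k], and the length [2 ^ (2 * k + 1)] of a list: this fixes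
    [M = 2 ^ (4 * k + 1)] and, as [4 * M], the number of colours. *)
Lemma size_forbidden : size (vals W) * size forbidden <= 2 ^ (4 * k + 1).
Proof.
have szW : size (vals W) <= k by rewrite size_map -cardE.
have szF : size forbidden <= k * 2 ^ (2 * k + 1).
  apply: leq_trans (_ : size (vals W) * 2 ^ (2 * k + 1) <= _); last first.
    by rewrite leq_mul2r szW orbT.
  rewrite /forbidden; elim: (vals W) => //= w s IH.
  by rewrite size_cat size_map mulSn leq_add ?size_sep_list.
apply: leq_trans (leq_mul szW szF) _.
have lt : k <= 2 ^ k by apply/ltnW/ltn_expl.
have -> : 4 * k + 1 = k + (k + (2 * k + 1)) by lia.
apply: (@leq_trans (2 ^ k * (2 ^ k * 2 ^ (2 * k + 1)))); last by rewrite -!expnD.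
by rewrite !leq_mul.
Qed.

Lemma output_cover : exists2 z, z \in output &
  W :&: vset G z = set0 /\ Y \subset vset G z.
Proof.
(* Without targets no separator exists, so [Y] is empty and the empty set put into the output from
   the start will do. *)
have [T0|T0] := eqVneq T set0.
  exists [::]; first by rewrite mem_output eqxx.
  split; first by apply/setP => u; rewrite !inE andbF.
  apply/subsetP => v /impY[W' [_ [[/and5P[_]]]]].
  by rewrite T0 eqxx.
have [l0 [szl nl _]] := size_ls.
pose q := 2 ^ (4 * k + 3); pose M := 2 ^ (4 * k + 1).
have forbP x : x \in forbidden ->
    exists w D, [/\ w \in W, D \in sep_list w & x = out_of_W D].
  case/flattenP => _ /mapP[w + ->] /mapP[D DL ->].
  by case/mapP => u; rewrite mem_enum => uW wu; exists u, D; rewrite -wu.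
have [h hH sep] : exists2 h, h \in H &
    {in vals W & forbidden, forall x y, color h x != color h y}.
  (* The [2 ^ (4 * k + 2)] rounds of [size ls] functions each are the [2 * M * l] functions of the
     hashing bound. *)
  have -> : H = iter (2 * M * size ls) (add_hash colors (down n)) [::].
    by rewrite /H hash_familyE size_down /M -expnS -addnS.
  apply: (separating_hash (l0 := l0)) size_forbidden => //.
  - by rewrite rev_uniq iota_uniq.
  - by rewrite rev_uniq iota_uniq.
  - by rewrite expn_gt0.
  - by rewrite size_down /M -(expnD 2 2) leq_exp2l //; lia.
  - by rewrite size_down.
  - by move=> x /mapP[u _ ->]; rewrite mem_down.
  - by move=> x /forbP[w [D [wW DL ->]]]; rewrite mem_down; case: (out_of_WP T0 wW DL).
  - apply/hasPn => x /forbP[w [D [wW DL ->]]] /=.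
    by case: (out_of_WP T0 wW DL).
have hcol x : color h x \in colors.
  have [H' ->] : exists H', h = new_hash colors (down n) H'.
    by move: hH; rewrite /H hash_familyE; apply: mem_iter_hash.
  have := color_new_hash colors (down n) H' x; rewrite inE => /orP[/eqP ->|//].
  by rewrite mem_down expn_gt0.
pose cols := [seq color h x | x <- vals W].
(* Padding with a colour already present gives length exactly [k] without changing the set of
   colours. If [W] is empty the padding is 0, and disjointness from [W] is trivial. *)
pose t := cols ++ nseq (k - size cols) (head 0 cols).
have szc : size cols <= k by rewrite !size_map -cardE.
have tP : t \in tuples colors k.
  apply: mem_tuples; first by rewrite size_cat size_nseq subnKC.
  have colsP x : x \in cols -> x \in colors by case/mapP => y _ ->.
  move=> x; rewrite mem_cat => /orP[/colsP //|]; rewrite mem_nseq => /andP[_ /eqP ->].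
  case: (cols) colsP => [_|c s]; first by rewrite /= mem_down expn_gt0.
  by apply; rewrite mem_head.
exists (shadow_set LL h t).
  by rewrite mem_output; apply/orP; right; apply/hasP; exists h => //; apply: map_f.
rewrite shadow_set_output; split.
  apply/setP => w; rewrite !inE; apply/negP => /andP[wW].
  rewrite mem_filter => /andP[/andP[_]] + _; rewrite some_coloredE => /hasP[D DL].
  rewrite all_coloredE => /allP al; have [oD oW _] := out_of_WP T0 wW DL.
  have : color h (out_of_W D) \in cols.
    have := al _ oD; rewrite mem_cat => /orP[//|]; rewrite mem_nseq => /andP[_ /eqP ->].
    have : color h w \in cols by apply: map_f; rewrite mem_vals.
    by case: (cols) => // c s _; rewrite mem_head.
  case/mapP => x xW ex; have := sep x (out_of_W D) xW; rewrite -ex eqxx.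
  case/(_ _)/negP => //; apply/flattenP; exists [seq out_of_W D | D <- sep_list w].
    by apply: map_f; rewrite mem_vals.
  exact: map_f.
apply/subsetP => v vY; have [W' [WW imp]] := impY vY.
have vT : v \notin T by case: imp => -[/and5P[_ _]]; rewrite disjoints1.
have [|D DL eD] := sep_list_complete imp.
  by apply: leq_trans (subset_leq_card WW) cardW.
have [vD _] := sep_list_sound T0 vT DL.
rewrite inE mem_filter mem_iota /= ltn_ord mem_vals vT /= andbT some_coloredE.
apply/hasP; exists D => //; rewrite all_coloredE; apply/allP => x xD.
have [u [xu _ _ _]] := vD _ xD; rewrite mem_cat; apply/orP; left.
apply: map_f; rewrite xu mem_vals; apply: (subsetP WW).
by rewrite -eD inE -xu.
Qed.

End Cover.

End Output.

(** * Evaluation with cost bounds *)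

(** With an upper bound instead of the exact time, costs can be left to unification during symbolic
    evaluation and compared with a budget at the end. *)
Definition ev P env e v c := exists2 t, t <= c & eval P env e v t.

Section Evaluation.
Variable P : program.
Implicit Types (env : seq data) (e : expr) (v w : data) (c : nat).

Lemma ev_weaken env e v c c' : ev P env e v c -> c <= c' -> ev P env e v c'.
Proof. by case=> t le et le'; exists t => //; apply: leq_trans le'. Qed.

Lemma ev_var env i v : nth (VNat 0) env i = v -> ev P env (EVar i) v 1.
Proof. by move=> <-; exists 1 => //; constructor. Qed.

Lemma ev_const env n : ev P env (EConst n) (VNat n) 1.
Proof. by exists 1 => //; constructor. Qed.

Lemma ev_add env e1 e2 a b v c1 c2 : ev P env e1 (VNat a) c1 ->
  ev P env e2 (VNat b) c2 -> v = VNat (a + b) -> ev P env (EAdd e1 e2) v (c1 + c2).+1.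
Proof.
move=> [t1 l1 E1] [t2 l2 E2] ->; exists (t1 + t2).+1; first by rewrite ltnS leq_add.
by constructor.
Qed.

Lemma ev_sub env e1 e2 a b v c1 c2 : ev P env e1 (VNat a) c1 ->
  ev P env e2 (VNat b) c2 -> v = VNat (a - b) -> ev P env (ESub e1 e2) v (c1 + c2).+1.
Proof.
move=> [t1 l1 E1] [t2 l2 E2] ->; exists (t1 + t2).+1; first by rewrite ltnS leq_add.
by constructor.
Qed.

Lemma ev_pair env e1 e2 v w c1 c2 : ev P env e1 v c1 -> ev P env e2 w c2 ->
  ev P env (EMkPair e1 e2) (VPair v w) (c1 + c2).+1.
Proof.
move=> [t1 l1 E1] [t2 l2 E2]; exists (t1 + t2).+1; first by rewrite ltnS leq_add.
by constructor.
Qed.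

Lemma ev_fst env e v w c : ev P env e (VPair v w) c -> ev P env (EFst e) v c.+1.
Proof. by move=> [t l E]; exists t.+1 => //; apply: EvFst E. Qed.

Lemma ev_snd env e v w c : ev P env e (VPair v w) c -> ev P env (ESnd e) w c.+1.
Proof. by move=> [t l E]; exists t.+1 => //; apply: EvSnd E. Qed.

Lemma ev_ispair env e v w c : ev P env e v c -> w = VNat (is_pair v) ->
  ev P env (EIsPair e) w c.+1.
Proof. by move=> [t l E] ->; exists t.+1 => //; apply: EvIsPair E. Qed.

(** Charging both branches makes the cost independent of the test. [ev_if0] and [ev_ifS] charge only
    the branch taken and serve where the outcome is known, as in recursive bodies. *)
Lemma ev_if env e e1 e2 n v c c1 c2 : ev P env e (VNat n) c ->
  (n <> 0 -> ev P env e1 v c1) -> (n = 0 -> ev P env e2 v c2) ->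
  ev P env (EIf e e1 e2) v (c + c1 + c2).+1.
Proof.
move=> [t l E] H1 H2.
have [t' le E'] : ev P env (if n == 0 then e2 else e1) v (c1 + c2).
  by case: eqP => [/H2|/H1] H; apply: ev_weaken H _; lia.
by exists (t + t').+1; [lia|apply: EvIf E E'].
Qed.

Lemma ev_if0 env e e1 e2 v c c2 : ev P env e (VNat 0) c -> ev P env e2 v c2 ->
  ev P env (EIf e e1 e2) v (c + c2).+1.
Proof.
move=> [t l E] [t' l' E']; exists (t + t').+1; first by rewrite ltnS leq_add.
by apply: EvIf E _.
Qed.

Lemma ev_ifS env e e1 e2 n v c c1 : ev P env e (VNat n.+1) c -> ev P env e1 v c1 ->
  ev P env (EIf e e1 e2) v (c + c1).+1.
Proof.
move=> [t l E] [t' l' E']; exists (t + t').+1; first by rewrite ltnS leq_add.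
by apply: EvIf E _.
Qed.

Lemma ev_let env e1 e2 v w c1 c2 : ev P env e1 v c1 -> ev P (v :: env) e2 w c2 ->
  ev P env (ELet e1 e2) w (c1 + c2).+1.
Proof.
move=> [t1 l1 E1] [t2 l2 E2]; exists (t1 + t2).+1; first by rewrite ltnS leq_add.
exact: EvLet E1 E2.
Qed.

Definition call f v w c := ev P [:: v] (nth (EConst 0) P f) w c.

Lemma ev_call env f e v w c1 c2 : ev P env e v c1 -> call f v w c2 ->
  ev P env (ECall f e) w (c1 + c2).+1.
Proof.
move=> [t1 l1 E1] [t2 l2 E2]; exists (t1 + t2).+1; first by rewrite ltnS leq_add.
exact: EvCall E1 E2.
Qed.

(** A conditional only tests for zero; the truncated differences in both directions add up to zero
    exactly for equal numbers. *)
Definition IfEq a b e1 e2 := EIf (EAdd (ESub a b) (ESub b a)) e2 e1.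

Lemma ev_ifeq env a b e1 e2 x y v c1 c2 c3 c4 :
  ev P env a (VNat x) c1 -> ev P env b (VNat y) c2 ->
  (x = y -> ev P env e1 v c3) -> (x <> y -> ev P env e2 v c4) ->
  ev P env (IfEq a b e1 e2) v (2 * (c1 + c2) + c3 + c4 + 5).
Proof.
move=> Ha Hb H1 H2; apply: ev_weaken.
  apply: (ev_if (n := (x - y) + (y - x)) (c1 := c4) (c2 := c3)).
  - by apply: ev_add => //; apply: ev_sub Ha Hb _ || apply: ev_sub Hb Ha _.
  - by move=> ne; apply: H2; lia.
  - by move=> ne; apply: H1; lia.
by lia.
Qed.

(** Unambiguous only if [f] yields pairs, since the program separates the two cases with
    [EIsPair]. *)
Definition enc_opt (A : Type) (f : A -> data) (o : option A) : data :=
  if o is Some x then f x else VNat 0.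

Definition IfPair e e1 e2 := EIf (EIsPair e) e1 e2.

Lemma ev_ifpair env e e1 e2 (A : Type) (f : A -> data) o v c c1 c2 :
  (forall x, is_pair (f x)) -> ev P env e (enc_opt f o) c ->
  (forall x, o = Some x -> ev P env e1 v c1) -> (o = None -> ev P env e2 v c2) ->
  ev P env (IfPair e e1 e2) v (c + c1 + c2 + 2).
Proof.
move=> fP He H1 H2; apply: ev_weaken.
  apply: (ev_if (n := isSome o) (c := c.+1) (c1 := c1) (c2 := c2)).
  - apply: ev_ispair He _; congr VNat.
    by case: (o) => //= x; rewrite fP.
  - by case: (o) H1 => // x H1 _; apply: H1.
  - by case: (o) H2 => // H2 _; apply: H2.
by lia.
Qed.

Definition encl (A : Type) (f : A -> data) (s : seq A) : data :=
  foldr (fun x d => VPair (f x) d) (VNat 0) s.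

End Evaluation.

(** Evaluates straight-line code symbolically and leaves branches and calls as goals. *)
Ltac evs :=
  lazymatch goal with
  | |- ev _ _ ?e0 _ _ => let e := eval hnf in e0 in
    lazymatch e with
    | EConst _ => apply: ev_const
    | EVar _ => eapply ev_var; reflexivity
    | EAdd _ _ => eapply ev_add; [evs | evs | try reflexivity]
    | ESub _ _ => eapply ev_sub; [evs | evs | try reflexivity]
    | EMkPair _ _ => eapply ev_pair; evs
    | EFst _ => eapply ev_fst; evs
    | ESnd _ => eapply ev_snd; evs
    | ELet _ _ => eapply ev_let; [evs | evs]
    | EIsPair _ => eapply ev_ispair; [evs | try reflexivity]
    | _ => idtac
    end
  | _ => idtac
  end.

Lemma In_mem (A : eqType) (a : A) s : List.In a s -> a \in s.
Proof.
elim: s => //= b s IH [->|/IH as_]; first exact: mem_head.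
by rewrite inE as_ orbT.
Qed.

Section Fold.
Variable P : program.

(* A loop over a list: on input [(ctx, (l, acc))], the step is run on each
   element of [l] in the environment [acc, element, ctx, input]. *)
Definition FOLD f step :=
  EIf (EIsPair (EFst (ESnd (EVar 0))))
    (ECall f (EMkPair (EFst (EVar 0)) (EMkPair (ESnd (EFst (ESnd (EVar 0))))
      (ELet (EFst (EVar 0)) (ELet (EFst (EFst (ESnd (EVar 1))))
        (ELet (ESnd (ESnd (EVar 2))) step))))))
    (ESnd (ESnd (EVar 0))).

Definition loop_cost m c := m * (c + 30) + 30.

(** The invariant is indexed by the number of elements processed, so that it can bound accumulators
    that grow with each step. The constants 30 cover the bookkeeping of the loop itself. *)
Lemma call_fold f step (A S : Type) (fa : A -> data) (fs : S -> data)
    (F : S -> A -> S) (I : nat -> S -> Prop) ctx s b m c r :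
  nth (EConst 0) P f = FOLD f step ->
  I 0 b ->
  (forall i b a w, i < size s -> List.In a s -> I i b ->
     I i.+1 (F b a) /\ ev P [:: fs b; fa a; ctx; w] step (fs (F b a)) c) ->
  size s <= m -> r = fs (foldl F b s) ->
  call P f (VPair ctx (VPair (encl fa s) (fs b))) r (loop_cost m c).
Proof.
move=> Pf I0 H le ->; rewrite /loop_cost.
apply: (@ev_weaken _ _ _ _ (size s * (c + 30) + 30)); last by rewrite leq_add2r leq_mul2r le orbT.
elim: s I b {le} I0 H => [|a s IH] I b I0 H; rewrite /call Pf /FOLD.
  apply: ev_weaken; first by eapply ev_if0; evs.
  by [].
have [I1 E] := H 0 b a (VPair ctx (VPair (encl fa (a :: s)) (fs b))) isT
  (or_introl erefl) I0.
have {}IH : call P f (VPair ctx (VPair (encl fa s) (fs (F b a))))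
    (fs (foldl F (F b a) s)) (size s * (c + 30) + 30).
  apply: (IH (fun i => I i.+1)) => // i b' a' w lt a's Ib.
  by apply: H => //; right.
apply: ev_weaken.
  eapply (@ev_ifS _ _ _ _ _ 0); first evs.
  eapply ev_call; last exact: IH.
  evs; exact: E.
by rewrite /= mulSn; lia.
Qed.

End Fold.

(** * The program *)

Definition CALLF f ctx l acc := ECall f (EMkPair ctx (EMkPair l acc)).

Definition f_down := 1.
Definition f_pow2 := 2.
Definition f_log := 3.
Definition f_rev := 4.
Definition f_mem := 5.
Definition f_lookup := 6.
Definition f_relax := 7.
Definition f_bfs := 8.
Definition f_init := 9.
Definition f_source := 10.
Definition f_rem := 11.
Definition f_augment := 12.
Definition f_flow := 13.
Definition f_crossing := 14.
Definition f_tree := 15.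
Definition f_repeat := 16.
Definition f_row := 17.
Definition f_network := 18.
Definition f_color := 19.
Definition f_weight := 20.
Definition f_cost := 21.
Definition f_best := 22.
Definition f_hash := 23.
Definition f_grow := 24.
Definition f_family := 25.
Definition f_colors := 26.
Definition f_extend := 27.
Definition f_tuples := 28.
Definition f_all := 29.
Definition f_some := 30.
Definition f_shadow := 31.
Definition f_shadows := 32.
Definition f_output := 33.
Definition f_seps := 34.

Definition body_down :=
  EIf (EVar 0)
    (ELet (ESub (EVar 0) (EConst 1)) (EMkPair (EVar 0) (ECall f_down (EVar 0))))
    (EConst 0).

Definition body_pow2 :=
  EIf (EVar 0)
    (ELet (ECall f_pow2 (ESub (EVar 0) (EConst 1))) (EAdd (EVar 0) (EVar 0)))
    (EConst 1).

Definition body_log :=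
  EIf (ESub (EFst (EVar 0)) (ESnd (EVar 0)))
    (EMkPair (EConst 0) (EMkPair (EConst 0)
       (ECall f_log (EMkPair (EFst (EVar 0)) (EAdd (ESnd (EVar 0)) (ESnd (EVar 0)))))))
    (EMkPair (EConst 0) (EConst 0)).

Definition step_rev := EMkPair (EVar 1) (EVar 0).

Definition step_mem := IfEq (EVar 1) (EVar 2) (EConst 1) (EVar 0).

Definition step_lookup := IfEq (EFst (EVar 1)) (EVar 2) (EVar 1) (EVar 0).

Definition LOOKUP x l := CALLF f_lookup x l (EConst 0).

Definition step_relax :=
  IfPair (LOOKUP (EFst (EVar 1)) (EVar 0)) (EVar 0)
    (ELet (LOOKUP (ESnd (EVar 1)) (EVar 0))
      (IfPair (EVar 0)
        (EMkPair (EMkPair (EFst (EVar 2)) (EMkPair (EVar 2) (ESnd (EVar 0)))) (EVar 1))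
        (EVar 1))).

Definition step_bfs := CALLF f_relax (EConst 0) (EVar 2) (EVar 0).

Definition step_init := EMkPair (EMkPair (EVar 1) (EConst 0)) (EVar 0).

Definition step_source :=
  ELet (LOOKUP (EVar 1) (EVar 2)) (IfPair (EVar 0) (EVar 0) (EVar 1)).

Definition step_rem :=
  let keep := EMkPair (EFst (EVar 0)) (EMkPair (EVar 1) (ESnd (EVar 0))) in
  EIf (EFst (EVar 0)) keep
    (IfEq (EFst (EVar 1)) (EFst (EVar 2))
      (IfEq (ESnd (EVar 1)) (ESnd (EVar 2))
        (EMkPair (EConst 1) (ESnd (EVar 0))) keep) keep).

Definition REM a l := ESnd (CALLF f_rem a l (EMkPair (EConst 0) (EConst 0))).

Definition step_augment :=
  EMkPair (EMkPair (ESnd (EVar 1)) (EFst (EVar 1))) (REM (EVar 1) (EVar 0)).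

(* Input [((B0, Src), (j, A))]; failure is [0] and success is boxed. *)
Definition body_flow :=
  let src i := ESnd (EFst (EVar i)) in
  let j i := EFst (ESnd (EVar i)) in
  let A i := ESnd (ESnd (EVar i)) in
  ELet (CALLF f_bfs (A 0) (A 0) (EFst (EFst (EVar 0))))
    (ELet (CALLF f_source (EVar 0) (src 1) (EConst 0))
      (IfPair (EVar 0)
        (EIf (j 2)
          (ECall f_flow (EMkPair (EFst (EVar 2)) (EMkPair (ESub (j 2) (EConst 1))
             (CALLF f_augment (EConst 0) (ESnd (EVar 0)) (A 2)))))
          (EConst 0))
        (EMkPair (EVar 1) (EConst 0)))).

Definition step_crossing :=
  IfPair (LOOKUP (EFst (EVar 1)) (EVar 2)) (EVar 0)
    (IfPair (LOOKUP (ESnd (EVar 1)) (EVar 2)) (EVar 1) (EVar 0)).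

(* Input [((B0, k), (m, (A, (D, (Src, acc)))))]. *)
Definition body_tree :=
  let par i := EFst (EVar i) in
  let m i := EFst (ESnd (EVar i)) in
  let A i := EFst (ESnd (ESnd (EVar i))) in
  let D i := EFst (ESnd (ESnd (ESnd (EVar i)))) in
  let src i := EFst (ESnd (ESnd (ESnd (ESnd (EVar i))))) in
  let acc i := ESnd (ESnd (ESnd (ESnd (ESnd (EVar i))))) in
  EIf (m 0)
    (ELet (ECall f_flow (EMkPair (EMkPair (EFst (par 0)) (src 0))
                                 (EMkPair (ESnd (par 0)) (A 0))))
      (IfPair (EVar 0)
        (ELet (CALLF f_crossing (EFst (EVar 0)) (A 1) (EConst 0))
          (IfPair (EVar 0)
            (ECall f_tree (EMkPair (par 2) (EMkPair (ESub (m 2) (EConst 1))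
              (EMkPair (REM (EVar 0) (A 2))
              (EMkPair (EMkPair (EFst (EVar 0)) (D 2)) (EMkPair (src 2)
                (ECall f_tree (EMkPair (par 2) (EMkPair (ESub (m 2) (EConst 1))
                  (EMkPair (A 2) (EMkPair (D 2)
                  (EMkPair (EMkPair (ESnd (EVar 0)) (src 2)) (acc 2)))))))))))))
            (EMkPair (D 2) (acc 2))))
        (acc 1)))
    (acc 0).

Definition step_repeat := EMkPair (EVar 2) (EVar 0).

Definition step_row :=
  CALLF f_repeat (EMkPair (ESnd (EVar 2)) (EVar 1)) (EFst (EVar 2)) (EVar 0).

Definition MEM x l := CALLF f_mem x l (EConst 0).

Definition step_network :=
  let cnt := EFst (EFst (EVar 3)) in
  let a := EMkPair (EFst (EVar 1)) (EVar 0) in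
  ELet (EAdd (ESnd (EVar 2)) (EFst (EVar 0)))
    (EMkPair (EAdd (EFst (EVar 1)) (EConst 1))
      (CALLF f_row (EMkPair cnt (EVar 0)) (EVar 2)
        (EIf (MEM (EFst (EVar 1)) (ESnd (EFst (EVar 3))))
          (CALLF f_repeat a cnt (ESnd (EVar 1)))
          (EMkPair a (ESnd (EVar 1)))))).

Definition body_color :=
  ELet (LOOKUP (EFst (EVar 0)) (ESnd (EVar 0)))
    (IfPair (EVar 0) (ESnd (EVar 0)) (EConst 0)).

Definition step_weight :=
  IfEq (ECall f_color (EMkPair (EFst (EVar 2)) (EVar 1)))
    (ECall f_color (EMkPair (ESnd (EVar 2)) (EVar 1)))
    (EAdd (EVar 0) (EVar 0)) (EVar 0).

Definition step_cost :=
  IfEq (ESnd (EVar 1)) (EFst (ESnd (EVar 2)))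
    (EAdd (EVar 0)
      (CALLF f_weight (EMkPair (EFst (EVar 2)) (EFst (EVar 1)))
         (ESnd (ESnd (EVar 2))) (EConst 1)))
    (EVar 0).

Definition step_best :=
  ELet (CALLF f_cost (EMkPair (EFst (EVar 2)) (EMkPair (EVar 1) (ESnd (ESnd (EVar 2)))))
         (EFst (ESnd (EVar 2))) (EConst 0))
    (EIf (ESub (ESnd (EVar 1)) (EVar 0)) (EMkPair (EVar 2) (EVar 0)) (EVar 1)).

Definition step_hash :=
  EMkPair
    (EMkPair (EVar 1)
      (EFst (CALLF f_best (EMkPair (EVar 1) (EMkPair (EVar 0) (ESnd (EVar 2))))
        (EFst (EVar 2))
        (EMkPair (EConst 0)
          (CALLF f_cost (EMkPair (EVar 1) (EMkPair (EConst 0) (ESnd (EVar 2))))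
             (EVar 0) (EConst 0))))))
    (EVar 0).

Definition step_grow :=
  EMkPair (CALLF f_hash (EMkPair (EFst (EVar 2)) (EVar 0)) (ESnd (EVar 2)) (EConst 0))
    (EVar 0).

Definition step_family := CALLF f_grow (EFst (EVar 2)) (ESnd (EVar 2)) (EVar 0).

Definition step_colors := EMkPair (EMkPair (EVar 1) (EVar 2)) (EVar 0).

Definition step_extend := CALLF f_colors (EVar 1) (EVar 2) (EVar 0).

Definition step_tuples := CALLF f_extend (EVar 2) (EVar 0) (EConst 0).

Definition step_all :=
  EIf (MEM (ECall f_color (EMkPair (EVar 1) (EFst (EVar 2)))) (ESnd (EVar 2)))
    (EVar 0) (EConst 0).

Definition step_some := EIf (CALLF f_all (EVar 2) (EVar 1) (EConst 1)) (EConst 1) (EVar 0).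

Definition step_shadow :=
  EIf (CALLF f_some (EVar 2) (ESnd (EVar 1)) (EConst 0))
    (EMkPair (EFst (EVar 1)) (EVar 0)) (EVar 0).

Definition step_shadows :=
  EMkPair (CALLF f_shadow (EMkPair (ESnd (EVar 2)) (EVar 1)) (EFst (EVar 2)) (EConst 0))
    (EVar 0).

Definition step_output :=
  CALLF f_shadows (EMkPair (EFst (EVar 2)) (EVar 1)) (ESnd (EVar 2)) (EVar 0).

(* The context is [(T, ((B0, k), (m, (n, A))))]. *)
Definition step_seps :=
  EIf (MEM (EVar 1) (EFst (EVar 2))) (EVar 0)
    (EMkPair
      (EMkPair (EVar 1)
        (ECall f_tree (EMkPair (EFst (ESnd (EVar 2)))
          (EMkPair (EFst (ESnd (ESnd (EVar 2))))
          (EMkPair (ESnd (ESnd (ESnd (ESnd (EVar 2)))))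
          (EMkPair (EConst 0)
          (EMkPair
            (EMkPair (EVar 1)
              (EMkPair (EAdd (EFst (ESnd (ESnd (ESnd (EVar 2))))) (EVar 1)) (EConst 0)))
            (EConst 0))))))))
      (EVar 0)).

(** The local accessors take the current de Bruijn index of the input, which grows by one with every
    [ELet]. *)
Definition body_main :=
  let n i := EFst (EVar i) in
  let adj i := EFst (ESnd (EVar i)) in
  let U i := EFst (ESnd (ESnd (EVar i))) in
  let T i := EFst (ESnd (ESnd (ESnd (EVar i)))) in
  let k i := ESnd (ESnd (ESnd (ESnd (EVar i)))) in
  let k4 i := EAdd (EAdd (k i) (k i)) (EAdd (k i) (k i)) in
  ELet (ECall f_down (n 0))
  (ELet (ECall f_down (ECall f_pow2 (EAdd (k4 1) (EConst 3))))
  (ELet (CALLF f_init (EConst 0) (T 2) (EConst 0))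
  (ELet (ESnd (CALLF f_network
           (EMkPair (EMkPair (ECall f_down (EAdd (k 3) (EConst 1))) (U 3)) (n 3))
           (adj 3) (EMkPair (EConst 0) (EConst 0))))
  (ELet (CALLF f_seps
           (EMkPair (T 4) (EMkPair (EMkPair (EVar 1) (k 4))
             (EMkPair (EAdd (EAdd (k 4) (k 4)) (EConst 1)) (EMkPair (n 4) (EVar 0)))))
           (CALLF f_rev (EConst 0) (EVar 3) (EConst 0)) (EConst 0))
  (ELet (CALLF f_family
           (EMkPair (EMkPair (EVar 3) (EVar 4)) (ECall f_log (EMkPair (n 5) (EConst 1))))
           (ECall f_down (ECall f_pow2 (EAdd (k4 5) (EConst 2)))) (EConst 0))
    (CALLF f_output
      (EMkPair (EVar 1)
        (CALLF f_tuples (EVar 4) (ECall f_down (k 6)) (EMkPair (EConst 0) (EConst 0))))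
      (EVar 0) (EMkPair (EConst 0) (EConst 0)))))))).

Definition prog : program :=
  [:: body_main; body_down; body_pow2; body_log; FOLD f_rev step_rev;
      FOLD f_mem step_mem; FOLD f_lookup step_lookup; FOLD f_relax step_relax;
      FOLD f_bfs step_bfs; FOLD f_init step_init; FOLD f_source step_source;
      FOLD f_rem step_rem; FOLD f_augment step_augment; body_flow;
      FOLD f_crossing step_crossing; body_tree; FOLD f_repeat step_repeat;
      FOLD f_row step_row; FOLD f_network step_network; body_color;
      FOLD f_weight step_weight; FOLD f_cost step_cost; FOLD f_best step_best;
      FOLD f_hash step_hash; FOLD f_grow step_grow; FOLD f_family step_family;
      FOLD f_colors step_colors; FOLD f_extend step_extend;
      FOLD f_tuples step_tuples; FOLD f_all step_all; FOLD f_some step_some;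
      FOLD f_shadow step_shadow; FOLD f_shadows step_shadows;
      FOLD f_output step_output; FOLD f_seps step_seps].

Definition enc_darc (a : darc) := VPair (VNat a.1) (VNat a.2).
Definition enc_entry (e : nat * seq darc) := VPair (VNat e.1) (encl enc_darc e.2).
Notation nats := (encl VNat).
Notation darcs := (encl enc_darc).
Notation entries := (encl enc_entry).

(* [m] bounds the length of every list except that of the colour tuples, whose
   length is [Q] below. *)
Section Costs.
Variable m : nat.

Definition Tcount := m * 20 + 20.
Definition Tsimple := loop_cost m 100.
Definition Trelax := loop_cost m (2 * Tsimple + 60).
Definition Tbfs := loop_cost m (Trelax + 30).
Definition Tsource := loop_cost m (Tsimple + 60).
Definition Taugment := loop_cost m (Tsimple + 60).
Definition Tflow := m * (Tbfs + Tsource + Taugment + 200).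
Definition Ttree := m * (Tflow + Trelax + Tsimple + 400).
Definition Trow := loop_cost m (Tsimple + 60).
Definition Tnetwork := loop_cost m (Trow + 2 * Tsimple + 100).
Definition Tcolor := Tsimple + 60.
Definition Tweight := loop_cost m (4 * Tcolor + 100).
Definition Tcost := loop_cost m (Tweight + 100).
Definition Tbest := loop_cost m (Tcost + 100).
Definition Thash := loop_cost m (Tbest + Tcost + 100).
Definition Tgrow := loop_cost m (Thash + 60).
Definition Tfamily := loop_cost m (Tgrow + 60).
Definition Tall := loop_cost m (Tsimple + Tcolor + 100).
Definition Tsome := loop_cost m (Tall + 60).
Definition Tshadow := loop_cost m (Tsome + 60).
Definition Tseps := loop_cost m (Tsimple + Ttree + 100).

End Costs.

(** * Correctness and cost of the program *)

Ltac fin := rewrite /=; nlia.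

Lemma call_down n m : n <= m -> call prog f_down (VNat n) (nats (down n)) (Tcount m).
Proof.
move=> le; apply: (@ev_weaken _ _ _ _ (n * 20 + 20)); last by rewrite leq_add2r leq_mul2r le orbT.
elim: n {le} => [|n IH]; rewrite ?downS /call /= /body_down; apply: ev_weaken.
- by eapply ev_if0; evs.
- fin.
- eapply ev_ifS; first evs.
  eapply (@ev_let _ _ _ _ (VNat n)); first by evs; congr VNat; lia.
  by evs; eapply ev_call; [evs | exact: IH].
- fin.
Qed.

Lemma call_pow2 j m : j <= m -> call prog f_pow2 (VNat j) (VNat (2 ^ j)) (Tcount m).
Proof.
move=> le; apply: (@ev_weaken _ _ _ _ (j * 20 + 20)); last by rewrite leq_add2r leq_mul2r le orbT.
elim: j {le} => [|j IH]; rewrite /call /= /body_pow2; apply: ev_weaken.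
- by eapply ev_if0; evs.
- fin.
- eapply ev_ifS; first evs.
  eapply (@ev_let _ _ _ _ (VNat (2 ^ j))).
    by eapply (@ev_call _ _ _ _ (VNat j)); [evs; congr VNat; lia | exact: IH].
  by evs; rewrite expnS mul2n addnn.
- fin.
Qed.

Lemma call_log fuel n p m : 0 < p -> n <= p + fuel -> fuel <= m ->
  call prog f_log (VPair (VNat n) (VNat p)) (nats (log_list fuel n p)) (loop_cost m 30).
Proof.
move=> + + le; move=> p0 np.
apply: (@ev_weaken _ _ _ _ (fuel * 60 + 30)); last by rewrite leq_add2r leq_mul2r le orbT.
elim: fuel p p0 np {le} => [|f IH] p p0 np; rewrite /call /= /body_log.
  apply: ev_weaken; first eapply ev_if0; evs.
    by congr VNat; lia.
  fin.
case: ltnP => lt; last first.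
  apply: ev_weaken; first eapply ev_if0; evs.
    by congr VNat; lia.
  fin.
apply: ev_weaken.
  eapply (@ev_ifS _ _ _ _ _ (n - p).-1); evs.
    by congr VNat; lia.
  by eapply ev_call; [evs | apply: IH; lia].
fin.
Qed.

Lemma call_rev s m : size s <= m ->
  call prog f_rev (VPair (VNat 0) (VPair (nats s) (VNat 0))) (nats (rev s)) (Tsimple m).
Proof.
move=> le.
apply: (@call_fold prog f_rev step_rev _ _ VNat (encl VNat) (fun l x => x :: l)
  (fun _ _ => True) _ s [::]) => //; last by rewrite foldl_cons map_id cats0.
by move=> i b a w _ _ _; split=> //; apply: ev_weaken; [evs | fin].
Qed.

Lemma call_mem x s m : size s <= m ->
  call prog f_mem (VPair (VNat x) (VPair (nats s) (VNat 0))) (VNat (x \in s)) (Tsimple m).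
Proof.
move=> le.
apply: (@call_fold prog f_mem step_mem _ _ VNat (fun b : bool => VNat b)
  (fun b y => if y == x then true else b) (fun _ _ => True) (VNat x) s false) => //; last first.
  congr VNat; congr nat_of_bool; elim/last_ind: s {le} => // s y IH.
  by rewrite foldl_rcons mem_rcons inE eq_sym -IH; case: eqP.
move=> i b a w _ _ _; split=> //; apply: ev_weaken.
  eapply ev_ifeq; [evs | evs | by move=> ->; rewrite eqxx; evs | ].
  by move=> /eqP/negPf ->; evs.
fin.
Qed.

Lemma call_lookup (V : Type) (fv : V -> data) x (B : seq (nat * V)) m : size B <= m ->
  let fe (e : nat * V) := VPair (VNat e.1) (fv e.2) in
  call prog f_lookup (VPair (VNat x) (VPair (encl fe B) (VNat 0)))
    (enc_opt fe (lookup x B)) (Tsimple m).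
Proof.
move=> le fe.
apply: (@call_fold prog f_lookup step_lookup _ _ fe (enc_opt fe)
  (fun r e => if e.1 == x then Some e else r) (fun _ _ => True) (VNat x) B None) => //.
move=> i b a w _ _ _; split=> //; apply: ev_weaken.
  eapply ev_ifeq; [evs | evs | by move=> ->; rewrite eqxx; evs | ].
  by move=> /eqP/negPf ->; evs.
fin.
Qed.

Lemma ev_lookup env x l (V : Type) (fv : V -> data) y (B : seq (nat * V)) m c1 c2 :
  let fe (e : nat * V) := VPair (VNat e.1) (fv e.2) in
  size B <= m -> ev prog env x (VNat y) c1 -> ev prog env l (encl fe B) c2 ->
  ev prog env (LOOKUP x l) (enc_opt fe (lookup y B)) (Tsimple m + c1 + c2 + 10).
Proof.
move=> fe le Hx Hl; apply: ev_weaken.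
  eapply ev_call; last exact: call_lookup le.
  by eapply ev_pair; [exact: Hx|eapply ev_pair; [exact: Hl|evs]].
fin.
Qed.

Lemma call_relax A B m : size B + size A <= m ->
  call prog f_relax (VPair (VNat 0) (VPair (darcs A) (entries B)))
    (entries (foldl relax B A)) (Trelax m).
Proof.
move=> le.
apply: (@call_fold prog f_relax step_relax _ _ enc_darc (encl enc_entry) relax
  (fun i B' => size B' <= size B + i)) => //;
  [by rewrite addn0| |exact: leq_trans (leq_addl _ _) le].
move=> i B' a w lt _ le'; split; first by have := size_relax B' a; lia.
have leB : size B' <= m by lia.
apply: ev_weaken.
  eapply (@ev_ifpair _ _ _ _ _ _ enc_entry (lookup a.1 B')) => //.
  - by eapply ev_lookup; [exact: leB | evs | evs].
  - by move=> e Ee; rewrite /relax Ee; evs.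
  - move=> E1; eapply ev_let; first by eapply ev_lookup; [exact: leB | evs | evs].
    eapply (@ev_ifpair _ _ _ _ _ _ enc_entry (lookup a.2 B')) => //.
    + by evs.
    + by move=> e E2; rewrite /relax E1 E2; evs.
    + by move=> E2; rewrite /relax E1 E2; evs.
fin.
Qed.

Lemma call_bfs A B m : size B + size A * size A <= m -> size A <= m ->
  call prog f_bfs (VPair (darcs A) (VPair (darcs A) (entries B)))
    (entries (bfs A B)) (Tbfs m).
Proof.
move=> le leA.
apply: (@call_fold prog f_bfs step_bfs _ _ enc_darc (encl enc_entry)
  (fun B _ => foldl relax B A) (fun i B' => size B' <= size B + i * size A)) => //.
  by rewrite addn0.
move=> i B' a w lt _ le'; split.
  by apply: leq_trans (size_round _ _) _; rewrite mulSn; nlia.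
apply: ev_weaken.
  eapply ev_call; first by evs.
  apply: call_relax (leq_trans _ le).
  apply: leq_trans (leq_add le' (leqnn _)) _.
  by rewrite -addnA leq_add2l -mulSnr leq_mul2r lt orbT.
fin.
Qed.

Lemma call_init Ts m : size Ts <= m ->
  call prog f_init (VPair (VNat 0) (VPair (nats Ts) (VNat 0)))
    (entries (targets_init Ts)) (Tsimple m).
Proof.
move=> le.
apply: (@call_fold prog f_init step_init _ _ VNat (encl enc_entry)
  (fun B t => (t, [::]) :: B) (fun _ _ => True) _ Ts [::]) => //.
by move=> i b a w _ _ _; split=> //; apply: ev_weaken; [evs | fin].
Qed.

Lemma call_source Src B m : size Src <= m -> size B <= m ->
  call prog f_source (VPair (entries B) (VPair (nats Src) (VNat 0)))
    (enc_opt enc_entry (find_source Src B)) (Tsource m).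
Proof.
move=> leS leB.
apply: (@call_fold prog f_source step_source _ _ VNat (enc_opt enc_entry)
  (fun r x => if lookup x B is Some e then Some e else r) (fun _ _ => True)
  (entries B) Src None) => //.
move=> i r x w _ _ _; split=> //; apply: ev_weaken.
  eapply ev_let; first by eapply ev_lookup; [exact: leB | evs | evs].
  eapply (@ev_ifpair _ _ _ _ _ _ enc_entry (lookup x B)) => //.
  - by evs.
  - by move=> e ->; evs.
  - by move=> ->; evs.
fin.
Qed.

Lemma ev_rem env ea el a A m c1 c2 : size A <= m ->
  ev prog env ea (enc_darc a) c1 -> ev prog env el (darcs A) c2 ->
  ev prog env (REM ea el) (darcs (rem_arc a A)) (Tsimple m + c1 + c2 + 10).
Proof.
move=> le Ha Hl.
pose fs (fo : bool * seq darc) := VPair (VNat fo.1) (darcs fo.2).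
have [v Hc] : exists v, call prog f_rem
    (VPair (enc_darc a) (VPair (darcs A) (VPair (VNat 0) (VNat 0))))
    (VPair v (darcs (rem_arc a A))) (Tsimple m).
  eexists; apply: (@call_fold prog f_rem step_rem _ _ enc_darc fs
    (fun fo b => if ~~ fo.1 && (b == a) then (true, fo.2) else (fo.1, b :: fo.2))
    (fun _ _ => True) (enc_darc a) A (false, [::]) m 100) => //.
  move=> i [fl o] [x y] w _ _ _; split=> //; case: a {Ha} => a1 a2; apply: ev_weaken.
    eapply ev_if; first by evs.
      by case: fl => //= _; evs.
    case: fl => //= _.
    eapply ev_ifeq; [by evs | by evs | move=> /= -> | move=> /= ne].
      eapply ev_ifeq; [by evs | by evs | move=> /= -> | move=> /= ne].
        by rewrite eqxx; evs.
      have -> : ((a1, y) == (a1, a2)) = false by apply/eqP => -[/ne].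
      by evs.
    have -> : ((x, y) == (a1, a2)) = false by apply/eqP => -[/ne].
    by evs.
  fin.
apply: ev_weaken.
  eapply ev_snd; eapply ev_call; last exact: Hc.
  by eapply ev_pair; [exact: Ha | eapply ev_pair; [exact: Hl | evs]].
fin.
Qed.

Lemma call_augment A p m : size A + size p <= m ->
  call prog f_augment (VPair (VNat 0) (VPair (darcs p) (darcs A)))
    (darcs (augment A p)) (Taugment m).
Proof.
move=> le.
apply: (@call_fold prog f_augment step_augment _ _ enc_darc (encl enc_darc)
  (fun A a => (a.2, a.1) :: rem_arc a A) (fun i A' => size A' <= size A + i)) => //.
- by rewrite addn0.
- move=> i A' a w lt _ le'; split.
    by rewrite /=; have := size_rem_arc a A'; nlia.
  have leA : size A' <= m by nlia.
  apply: ev_weaken.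
    by eapply ev_pair; [evs | eapply ev_rem; [exact: leA | evs | evs]].
  fin.
- nlia.
Qed.

Definition enc_flow (o : option (seq (nat * seq darc))) :=
  enc_opt (fun B => VPair (entries B) (VNat 0)) o.

(** Augmentation preserves the number of arcs, so one bound [m] serves all iterations. A reversed
    walk is no longer than the list of entries, because its tails are distinct keys of that list. *)
Lemma call_flow (B0 : seq (nat * seq darc)) j (A : seq darc) Src m :
  (forall e, e \in B0 -> e.2 = [::]) ->
  size Src <= m -> size A + (size B0 + size A * size A) <= m ->
  call prog f_flow (VPair (VPair (entries B0) (nats Src)) (VPair (VNat j) (darcs A)))
    (enc_flow (flow B0 j A Src)) (j.+1 * (Tbfs m + Tsource m + Taugment m + 200)).
Proof.
move=> B0n leS leA.
have step A' : size A' = size A -> forall e, find_source Src (bfs A' B0) = Some e ->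
    size (augment A' e.2) = size A /\ size A' + size e.2 <= m.
  move=> szA e /find_source_some[eB _].
  have [_ sub ue ke] := path_inv_bfs B0n eB.
  rewrite size_augment //; split=> //; apply: leq_trans leA.
  rewrite szA leq_add2l -szA; apply: leq_trans (size_bfs A' B0).
  by have := uniq_leq_size ue ke; rewrite !size_map.
suff H A' : size A' = size A ->
  call prog f_flow (VPair (VPair (entries B0) (nats Src)) (VPair (VNat j) (darcs A')))
    (enc_flow (flow B0 j A' Src)) (j.+1 * (Tbfs m + Tsource m + Taugment m + 200)).
  exact: H.
elim: j A' => [|j IH] A' szA; rewrite /call /=.
all: have leB : size (bfs A' B0) <= m by apply: leq_trans (size_bfs _ _) _; rewrite szA; nlia.
all: apply: ev_weaken; first (eapply ev_let;
  [eapply ev_call; [by evs|apply: (@call_bfs _ _ m); rewrite szA; nlia]|];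
  eapply ev_let; [eapply ev_call; [by evs|apply: call_source leS leB]|];
  eapply (@ev_ifpair _ _ _ _ _ _ enc_entry (find_source Src (bfs A' B0))) => //;
  [by evs | move=> e Ee | move=> Ee]).
- by rewrite Ee; eapply ev_if0; evs.
- by rewrite Ee; evs.
- fin.
- rewrite Ee; have [sz1 sz2] := step _ szA _ Ee.
  eapply ev_ifS; first by evs.
  eapply ev_call; last exact: IH sz1.
  evs; first by congr VNat; lia.
  by eapply ev_call; [by evs | apply: call_augment sz2].
- by rewrite Ee; evs.
- fin.
Qed.

Lemma call_crossing A B m : size A <= m -> size B <= m ->
  call prog f_crossing (VPair (entries B) (VPair (darcs A) (VNat 0)))
    (enc_opt enc_darc (crossing A B)) (Trelax m).
Proof.
move=> leA leB.
apply: (@call_fold prog f_crossing step_crossing _ _ enc_darc (enc_opt enc_darc)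
  (fun r a => if (a.1 \notin unzip1 B) && (a.2 \in unzip1 B) then Some a else r)
  (fun _ _ => True) (entries B) A None) => //.
move=> i r a w _ _ _; split=> //; rewrite -!isSome_lookup; apply: ev_weaken.
  eapply (@ev_ifpair _ _ _ _ _ _ enc_entry (lookup a.1 B)) => //.
  - by eapply ev_lookup; [exact: leB | evs | evs].
  - by move=> e ->; evs.
  - move=> ->; eapply (@ev_ifpair _ _ _ _ _ _ enc_entry (lookup a.2 B)) => //.
    + by eapply ev_lookup; [exact: leB | evs | evs].
    + by move=> e ->; evs.
    + by move=> ->; evs.
fin.
Qed.

Lemma size_flow (B0 : seq (nat * seq darc)) j (A : seq darc) Src B :
  (forall e, e \in B0 -> e.2 = [::]) -> flow B0 j A Src = Some B ->
  size B <= size B0 + size A * size A.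
Proof.
move=> B0n; elim: j A => [|j IH] A /=; case E: (find_source _ _) => [e|] //.
- by case=> <-; apply: size_bfs.
- have [eB _] := find_source_some E; have [_ sub ue _] := path_inv_bfs B0n eB.
  by move=> /IH; rewrite size_augment.
- by case=> <-; apply: size_bfs.
Qed.

Lemma size_tree_mem B0 k m A D Src acc E : E \in tree B0 k m A D Src acc ->
  E \in acc \/ size E <= size D + m.
Proof.
elim: m A D Src acc => [|m IH] A D Src acc /=; first by left.
case: flow => [B|]; last by left.
case: crossing => [a|]; last first.
  by rewrite inE => /orP[/eqP ->|]; [right; rewrite leq_addr|left].
case/IH => [/IH[]|] /=; [by left|by right; nlia|by right; nlia].
Qed.

Notation sets := (encl (encl VNat)).

Lemma call_tree (B0 : seq (nat * seq darc)) k j (A : seq darc) D Src acc m :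
  (forall e, e \in B0 -> e.2 = [::]) -> k < m ->
  size Src + j <= m -> size A + (size B0 + size A * size A) <= m -> 2 ^ j <= m ->
  call prog f_tree
    (VPair (VPair (entries B0) (VNat k))
      (VPair (VNat j) (VPair (darcs A) (VPair (nats D) (VPair (nats Src) (sets acc))))))
    (sets (tree B0 k j A D Src acc)) (Ttree m).
Proof.
move=> B0n km leS leA lem; set Y := Tflow m + Trelax m + Tsimple m + 300.
(* Adding [Y], which dominates the work at one node, turns the recurrence into
   [c + Y <= (c1 + Y) + (c2 + Y)], which doubles from level to level. *)
suff [c cY Hc] : exists2 c, c + Y <= 2 ^ j * (Y + 40) & call prog f_tree
    (VPair (VPair (entries B0) (VNat k))
      (VPair (VNat j) (VPair (darcs A) (VPair (nats D) (VPair (nats Src) (sets acc))))))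
    (sets (tree B0 k j A D Src acc)) c.
  apply: ev_weaken Hc _; apply: leq_trans (leq_addr Y c) _; apply: leq_trans cY _.
  by apply: leq_mul => //; rewrite /Y; nlia.
elim: j A D Src acc leS leA {lem} => [|j IH] A D Src acc leS leA.
  exists 40; first by rewrite mul1n addnC.
  by rewrite /call /=; apply: ev_weaken; [eapply ev_if0; evs | fin].
have leS' : size Src <= m by nlia.
have Hf : call prog f_flow (VPair (VPair (entries B0) (nats Src)) (VPair (VNat k) (darcs A)))
    (enc_flow (flow B0 k A Src)) (Tflow m).
  by apply: ev_weaken (call_flow k B0n leS' leA) _; rewrite leq_mul2r km orbT.
have zY : Y + 40 <= 2 ^ j * (Y + 40) by rewrite leq_pmull // expn_gt0.
rewrite expnS -mulnA /call /=.
case Ef: (flow B0 k A Src) Hf => [B|] Hf; last first.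
  eexists; last first.
    eapply ev_ifS; first by evs.
    eapply ev_let; first by eapply ev_call; [evs | exact: Hf].
    by eapply ev_if0; evs.
  by move: zY; rewrite /Y; nlia.
have leB : size B <= m by apply: leq_trans (size_flow B0n Ef) _; nlia.
have leA' : size A <= m by nlia.
have Hc := call_crossing leA' leB.
case Ec: (crossing A B) Hc => [a|] Hc; last first.
  eexists; last first.
    eapply ev_ifS; first by evs.
    eapply ev_let; first by eapply ev_call; [evs | exact: Hf].
    eapply (@ev_ifS _ _ _ _ _ 0); first by evs.
    eapply ev_let; first by eapply ev_call; [evs | exact: Hc].
    by eapply ev_if0; evs.
  by move: zY; rewrite /Y; nlia.
have [||c1 le1 H1] := IH A D (a.2 :: Src) acc; [by rewrite /=; nlia|by []|].
have szr := size_rem_arc a A.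
have [||c2 le2 H2] := IH (rem_arc a A) (a.1 :: D) Src (tree B0 k j A D (a.2 :: Src) acc).
- by nlia.
- by apply: leq_trans leA; rewrite !leq_add ?leq_mul.
eexists; last first.
  eapply ev_ifS; first by evs.
  eapply ev_let; first by eapply ev_call; [evs | exact: Hf].
  eapply (@ev_ifS _ _ _ _ _ 0); first by evs.
  eapply ev_let; first by eapply ev_call; [evs | exact: Hc].
  eapply (@ev_ifS _ _ _ _ _ 0); first by evs.
  eapply ev_call; last exact: H2.
  eapply ev_pair; first by evs.
  eapply ev_pair; first by evs; congr VNat; lia.
  eapply ev_pair; first by eapply ev_rem; [exact: leA' | evs | evs].
  eapply ev_pair; first by evs.
  eapply ev_pair; first by evs.
  eapply ev_call; last exact: H1.
  eapply ev_pair; first by evs.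
  by evs; congr VNat; lia.
by move: le1 le2; rewrite /Y; nlia.
Qed.

Lemma call_repeat T (f : T -> data) a (cnt : seq nat) (l : seq T) m : size cnt <= m ->
  call prog f_repeat (VPair (f a) (VPair (nats cnt) (encl f l)))
    (encl f (repeat_cons cnt a l)) (Tsimple m).
Proof.
move=> le.
apply: (@call_fold prog f_repeat step_repeat _ _ VNat (encl f) (fun l _ => a :: l)
  (fun _ _ => True)) => //.
by move=> i b x w _ _ _; split=> //; apply: ev_weaken; [evs | fin].
Qed.

Lemma call_row cnt x row l m : size cnt <= m -> size row <= m ->
  call prog f_row (VPair (VPair (nats cnt) (VNat x)) (VPair (nats row) (darcs l)))
    (darcs (row_arcs cnt x row l)) (Trow m).
Proof.
move=> lec ler.
apply: (@call_fold prog f_row step_row _ _ VNat (encl enc_darc)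
  (fun l w => repeat_cons cnt (x, w) l) (fun _ _ => True)) => //.
move=> i b y w _ _ _; split=> //; apply: ev_weaken.
  by eapply ev_call; [evs | exact: (@call_repeat darc enc_darc (x, y) _ _ m lec)].
fin.
Qed.

Lemma ev_mem env x l y s m c1 c2 : size s <= m ->
  ev prog env x (VNat y) c1 -> ev prog env l (nats s) c2 ->
  ev prog env (MEM x l) (VNat (y \in s)) (Tsimple m + c1 + c2 + 10).
Proof.
move=> le Hx Hl; apply: ev_weaken.
  eapply ev_call; last exact: call_mem le.
  by eapply ev_pair; [exact: Hx|eapply ev_pair; [exact: Hl|evs]].
fin.
Qed.

Lemma call_network cnt U n adj m : size cnt <= m -> size U <= m -> size adj <= m ->
  (forall row, row \in adj -> size row <= m) ->
  exists v, call prog f_network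
    (VPair (VPair (VPair (nats cnt) (nats U)) (VNat n))
       (VPair (encl (encl VNat) adj) (VPair (VNat 0) (VNat 0))))
    (VPair v (darcs (network cnt U n adj))) (Tnetwork m).
Proof.
move=> lec leU lea ler.
pose fs (ul : nat * seq darc) := VPair (VNat ul.1) (darcs ul.2).
eexists; apply: (@call_fold prog f_network step_network _ _ (encl VNat) fs
  (vertex_arcs cnt U n) (fun _ _ => True) _ adj (0, [::])) => //.
move=> i [u l] row w _ /In_mem/ler lerow _; split=> //; apply: ev_weaken.
  rewrite /vertex_arcs /fs /=; evs; first by rewrite addn1.
  eapply ev_call; last exact: (call_row _ _ lec lerow).
  evs; eapply (@ev_if _ _ _ _ _ (u \in U)).
  - by eapply ev_mem; [exact: leU | evs | evs].
  - case: (u \in U) => // _.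
    by eapply ev_call; [evs | exact: (@call_repeat darc enc_darc (u, n + u) _ _ m lec)].
  - by case: (u \in U) => // _; evs.
fin.
Qed.

Notation hashes := (encl (encl enc_darc)).

Lemma call_color x (h : seq (nat * nat)) m : size h <= m ->
  call prog f_color (VPair (VNat x) (darcs h)) (VNat (color h x)) (Tcolor m).
Proof.
move=> le; rewrite /call /=; apply: ev_weaken.
  eapply ev_let; first by eapply ev_lookup; [exact: le | evs | evs].
  eapply (@ev_ifpair _ _ _ _ _ _ enc_darc (lookup x h)) => //.
  - by evs.
  - by move=> e Ee; rewrite /color Ee; evs.
  - by move=> Ee; rewrite /color Ee; evs.
rewrite /Tcolor; fin.
Qed.

Lemma call_weight x y (H : seq (seq (nat * nat))) m : size H <= m ->
  (forall h, h \in H -> size h <= m) ->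
  call prog f_weight (VPair (VPair (VNat x) (VNat y)) (VPair (hashes H) (VNat 1)))
    (VNat (weight H x y)) (Tweight m).
Proof.
move=> leH leh.
apply: (@call_fold prog f_weight step_weight _ _ (encl enc_darc) VNat
  (fun w h => if color h x == color h y then w + w else w) (fun _ _ => True)) => //.
move=> i b h w _ /In_mem/leh le _; split=> //; apply: ev_weaken.
  eapply ev_ifeq.
  - by eapply ev_call; [evs | exact: call_color le].
  - by eapply ev_call; [evs | exact: call_color le].
  - by move=> ->; rewrite eqxx; evs.
  - by move=> /eqP/negPf ->; evs.
fin.
Qed.

Lemma call_cost x c (H : seq (seq (nat * nat))) h m : size H <= m ->
  (forall h, h \in H -> size h <= m) -> size h <= m ->
  call prog f_cost (VPair (VPair (VNat x) (VPair (VNat c) (hashes H))) (VPair (darcs h) (VNat 0)))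
    (VNat (cost H h x c)) (Tcost m).
Proof.
move=> leH leh le.
apply: (@call_fold prog f_cost step_cost _ _ enc_darc VNat
  (fun s e => if e.2 == c then s + weight H x e.1 else s) (fun _ _ => True)) => //.
move=> i b e w _ _ _; split=> //; apply: ev_weaken.
  eapply ev_ifeq; [evs | evs | move=> -> | move=> /eqP/negPf ->; evs].
  rewrite eqxx; evs.
  by eapply ev_call; [evs | exact: (@call_weight x e.1 H m)].
fin.
Qed.

Lemma call_best colors x (H : seq (seq (nat * nat))) h m : size H <= m ->
  (forall h, h \in H -> size h <= m) -> size h <= m -> size colors <= m ->
  call prog f_best (VPair (VPair (VNat x) (VPair (darcs h) (hashes H)))
      (VPair (nats colors) (VPair (VNat 0) (VNat (cost H h x 0)))))
    (enc_darc (best colors H h x)) (Tbest m).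
Proof.
move=> leH leh le lec.
apply: (@call_fold prog f_best step_best _ _ VNat enc_darc
  (fun bc c => if cost H h x c < bc.2 then (c, cost H h x c) else bc)
  (fun _ _ => True) _ colors (0, cost H h x 0)) => //.
move=> i [b s] c w _ _ _; split=> //; apply: ev_weaken.
  eapply ev_let; first by eapply ev_call; [evs | apply: (@call_cost _ _ _ _ m); eassumption].
  eapply ev_if; first by evs.
    by move=> /= ne; rewrite /= (_ : (_ < s) = true); [evs | lia].
  by move=> /= ne; rewrite /= (_ : (_ < s) = false); [evs | lia].
fin.
Qed.

Lemma call_hash colors vs (H : seq (seq (nat * nat))) m : size H <= m ->
  (forall h, h \in H -> size h <= m) -> size vs <= m -> size colors <= m ->
  call prog f_hash (VPair (VPair (nats colors) (hashes H)) (VPair (nats vs) (VNat 0)))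
    (darcs (new_hash colors vs H)) (Thash m).
Proof.
move=> leH leh le lec.
apply: (@call_fold prog f_hash step_hash _ _ VNat (encl enc_darc)
  (fun h x => (x, (best colors H h x).1) :: h) (fun i h => size h <= i) _ vs [::]) => //.
move=> i h x w lt _ lei; split=> //; have le_h : size h <= m by nlia.
apply: ev_weaken.
  evs; eapply ev_call; last by apply: (@call_best _ _ _ _ m); eassumption.
  by evs; eapply ev_call; [evs | apply: (@call_cost _ _ _ _ m); eassumption].
fin.
Qed.

Lemma size_new_hash colors vs H : size (new_hash colors vs H) = size vs.
Proof. by rewrite -(size_map fst) -/(unzip1 _) unzip1_new_hash size_rev. Qed.

Lemma call_grow colors vs (ls : seq nat) (H : seq (seq (nat * nat))) m :
  size H + size ls <= m -> (forall h, h \in H -> size h <= m) ->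
  size vs <= m -> size colors <= m ->
  call prog f_grow (VPair (VPair (nats colors) (nats vs)) (VPair (nats ls) (hashes H)))
    (hashes (foldl (fun H _ => add_hash colors vs H) H ls)) (Tgrow m).
Proof.
move=> leH leh lev lec.
apply: (@call_fold prog f_grow step_grow _ _ VNat (encl (encl enc_darc))
  (fun H _ => add_hash colors vs H)
  (fun i H' => size H' = size H + i /\ forall h, h \in H' -> size h <= m)) => //.
- by rewrite addn0.
- move=> i H' x w lt _ [szH leh']; split.
    rewrite /= szH addnS; split=> // h; rewrite inE => /orP[/eqP ->|/leh' //].
    by rewrite size_new_hash.
  have leH' : size H' <= m by nlia.
  apply: ev_weaken.
    by evs; eapply ev_call; [evs | apply: (@call_hash _ _ _ m); eassumption].
  fin.
- nlia.
Qed.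

Lemma call_family colors vs ls (rs : seq nat) m :
  size rs * size ls <= m -> size rs <= m -> size vs <= m -> size colors <= m ->
  call prog f_family
    (VPair (VPair (VPair (nats colors) (nats vs)) (nats ls)) (VPair (nats rs) (VNat 0)))
    (hashes (hash_family colors vs ls rs)) (Tfamily m).
Proof.
move=> le ler lev lec.
apply: (@call_fold prog f_family step_family _ _ VNat (encl (encl enc_darc))
  (fun H _ => foldl (fun H _ => add_hash colors vs H) H ls)
  (fun i H => size H = i * size ls /\ forall h, h \in H -> size h <= m) _ rs [::]) => //.
move=> i H x w lt _ [szH leh].
have szl : size H + size ls <= m.
  by rewrite szH -mulSnr; apply: leq_trans le; rewrite leq_mul2r lt orbT.
split.
  rewrite foldl_const mulSnr -szH; elim: (size ls) => [|l [IH1 IH2]] /=; first by rewrite addn0.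
  rewrite IH1 addnS; split=> // h; rewrite inE => /orP[/eqP ->|/IH2 //].
  by rewrite size_new_hash.
apply: ev_weaken; first by eapply ev_call; [evs | exact: (@call_grow _ _ _ _ m)].
fin.
Qed.

Definition Textend m Q := loop_cost Q (Tsimple m + 60).
Definition Ttuples m Q := loop_cost m (Textend m Q + 60).

Lemma call_colors colors (t : seq nat) acc m : size colors <= m ->
  call prog f_colors (VPair (nats t) (VPair (nats colors) (sets acc)))
    (sets (foldl (fun acc c => (c :: t) :: acc) acc colors)) (Tsimple m).
Proof.
move=> le; apply: (@call_fold prog f_colors step_colors _ _ VNat (encl (encl VNat))
  (fun acc c => (c :: t) :: acc) (fun _ _ => True)) => //.
by move=> i b x w _ _ _; split=> //; apply: ev_weaken; [evs | fin].
Qed.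

Lemma call_extend colors ts m Q : size colors <= m -> size ts <= Q ->
  call prog f_extend (VPair (nats colors) (VPair (sets ts) (VNat 0)))
    (sets (extend_tuples colors ts)) (Textend m Q).
Proof.
move=> le leQ; apply: (@call_fold prog f_extend step_extend _ _ (encl VNat) (encl (encl VNat))
  (fun acc t => foldl (fun acc c => (c :: t) :: acc) acc colors)
  (fun _ _ => True) _ ts [::]) => //.
move=> i b t w _ _ _; split=> //; apply: ev_weaken.
  by eapply ev_call; [evs | exact: call_colors le].
fin.
Qed.

Lemma call_tuples colors k m : 0 < size colors -> size colors <= m -> k <= m ->
  call prog f_tuples (VPair (nats colors) (VPair (nats (down k)) (VPair (VNat 0) (VNat 0))))
    (sets (tuples colors k)) (Ttuples m (size colors ^ k)).
Proof.
move=> c0 lec lek.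
apply: (@call_fold prog f_tuples step_tuples _ _ VNat (encl (encl VNat))
  (fun ts _ => extend_tuples colors ts) (fun i ts => size ts = size colors ^ i)
  _ (down k) [:: [::]]) => //; rewrite ?size_down //; last first.
  by rewrite foldl_const size_down.
move=> i ts x w lt _ szt; rewrite size_extend_tuples szt -expnSr; split=> //.
apply: ev_weaken.
  eapply ev_call; [evs | apply: (@call_extend _ _ m (size colors ^ k)) => //].
  by rewrite szt leq_pexp2l // ltnW.
fin.
Qed.

Lemma size_mem_tuples colors k t : t \in tuples colors k -> size t = k.
Proof.
elim: k t => [|k IH] t /=; first by rewrite inE => /eqP ->.
rewrite extend_tuplesE; move: IH; rewrite /tuples.
set ts := iter k _ _; elim/last_ind: ts => // ts u IH2 IH.
rewrite foldl_rcons mem_cat mem_rev => /orP[/mapP[c _ ->] /=|/IH2 -> //].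
  by rewrite IH // mem_rcons mem_head.
by move=> v vt; apply: IH; rewrite mem_rcons inE vt orbT.
Qed.

Lemma call_all (h : seq (nat * nat)) t D m : size h <= m -> size t <= m -> size D <= m ->
  call prog f_all (VPair (VPair (darcs h) (nats t)) (VPair (nats D) (VNat 1)))
    (VNat (all_colored h t D)) (Tall m).
Proof.
move=> leh let_ leD.
apply: (@call_fold prog f_all step_all _ _ VNat (fun b : bool => VNat b)
  (fun b x => if color h x \in t then b else false) (fun _ _ => True) _ D true) => //.
move=> i b x w _ _ _; split=> //; apply: ev_weaken.
  eapply (@ev_if _ _ _ _ _ (color h x \in t)).
  - eapply ev_mem; [exact: let_ | | evs].
    by eapply ev_call; [evs | exact: call_color leh].
  - by case: (_ \in t) => // _; evs.
  - by case: (_ \in t) => // _; evs.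
fin.
Qed.

Lemma call_some (h : seq (nat * nat)) t (L : seq (seq nat)) m :
  size h <= m -> size t <= m -> size L <= m ->
  (forall D, D \in L -> size D <= m) ->
  call prog f_some (VPair (VPair (darcs h) (nats t)) (VPair (sets L) (VNat 0)))
    (VNat (some_colored h t L)) (Tsome m).
Proof.
move=> leh let_ leL leD.
apply: (@call_fold prog f_some step_some _ _ (encl VNat) (fun b : bool => VNat b)
  (fun b D => if all_colored h t D then true else b) (fun _ _ => True) _ L false) => //.
move=> i b D w _ /In_mem/leD le _; split=> //; apply: ev_weaken.
  eapply (@ev_if _ _ _ _ _ (all_colored h t D)).
  - by eapply ev_call; [evs | exact: call_all leh let_ le].
  - by case: all_colored => // _; evs.
  - by case: all_colored => // _; evs.
fin.
Qed.

Definition enc_sep (vL : nat * seq (seq nat)) := VPair (VNat vL.1) (sets vL.2).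

Definition small_seps m (LL : seq (nat * seq (seq nat))) :=
  size LL <= m /\ forall vL, vL \in LL ->
  size vL.2 <= m /\ forall D, D \in vL.2 -> size D <= m.

Lemma call_shadow (h : seq (nat * nat)) t LL m :
  size h <= m -> size t <= m -> small_seps m LL ->
  call prog f_shadow (VPair (VPair (darcs h) (nats t)) (VPair (encl enc_sep LL) (VNat 0)))
    (nats (shadow_set LL h t)) (Tshadow m).
Proof.
move=> leh let_ [leL sL].
apply: (@call_fold prog f_shadow step_shadow _ _ enc_sep (encl VNat)
  (fun acc vL => if some_colored h t vL.2 then vL.1 :: acc else acc)
  (fun _ _ => True) _ LL [::]) => //.
move=> i b vL w _ /In_mem/sL[le1 le2] _; split=> //; apply: ev_weaken.
  eapply (@ev_if _ _ _ _ _ (some_colored h t vL.2)).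
  - by eapply ev_call; [evs | exact: call_some leh let_ le1 le2].
  - by case: some_colored => // _; evs.
  - by case: some_colored => // _; evs.
fin.
Qed.

Definition Tshadows m Q := loop_cost Q (Tshadow m + 60).
Definition Toutput m Q := loop_cost m (Tshadows m Q + 60).

Lemma call_shadows (h : seq (nat * nat)) (ts : seq (seq nat)) LL acc m Q :
  size h <= m -> (forall t, t \in ts -> size t <= m) -> size ts <= Q ->
  small_seps m LL ->
  call prog f_shadows (VPair (VPair (encl enc_sep LL) (darcs h)) (VPair (sets ts) (sets acc)))
    (sets (shadow_sets LL ts acc h)) (Tshadows m Q).
Proof.
move=> leh let_ leQ sL.
apply: (@call_fold prog f_shadows step_shadows _ _ (encl VNat) (encl (encl VNat))
  (fun acc t => shadow_set LL h t :: acc) (fun _ _ => True)) => //.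
move=> i b t w _ /In_mem/let_ le _; split=> //; apply: ev_weaken.
  by evs; eapply ev_call; [evs | exact: call_shadow leh le sL].
fin.
Qed.

Lemma call_output (H : seq (seq (nat * nat))) (ts : seq (seq nat)) LL m Q :
  size H <= m -> (forall h, h \in H -> size h <= m) ->
  (forall t, t \in ts -> size t <= m) -> size ts <= Q -> small_seps m LL ->
  call prog f_output
    (VPair (VPair (encl enc_sep LL) (sets ts))
       (VPair (hashes H) (VPair (VNat 0) (VNat 0))))
    (sets (foldl (shadow_sets LL ts) [:: [::]] H)) (Toutput m Q).
Proof.
move=> leH leh let_ leQ sL.
apply: (@call_fold prog f_output step_output _ _ (encl enc_darc) (encl (encl VNat))
  (shadow_sets LL ts) (fun _ _ => True) _ H [:: [::]]) => //.
move=> i b h w _ /In_mem/leh le _; split=> //; apply: ev_weaken.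
  by eapply ev_call; [evs | exact: call_shadows le let_ leQ sL].
fin.
Qed.

Lemma call_seps (B0 : seq (nat * seq darc)) k n (A : seq darc) Ts vs m :
  (forall e, e \in B0 -> e.2 = [::]) -> size Ts <= m -> size vs <= m ->
  2 * k + 3 <= m -> size A + (size B0 + size A * size A) <= m ->
  2 ^ (k + k).+1 <= m ->
  call prog f_seps
    (VPair (VPair (nats Ts) (VPair (VPair (entries B0) (VNat k))
       (VPair (VNat (k + k).+1) (VPair (VNat n) (darcs A))))) (VPair (nats vs) (VNat 0)))
    (encl enc_sep (separator_lists B0 k n A Ts vs)) (Tseps m).
Proof.
move=> B0n leT lev lek leA le2.
apply: (@call_fold prog f_seps step_seps _ _ VNat (encl enc_sep)
  (fun acc v => if v \in Ts then acc else
           (v, tree B0 k (k + k).+1 A [::] [:: v; n + v] [::]) :: acc)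
  (fun _ _ => True) _ vs [::]) => //.
move=> i b v w _ _ _; split=> //; apply: ev_weaken.
  eapply (@ev_if _ _ _ _ _ (v \in Ts)).
  - by eapply ev_mem; [exact: leT | evs | evs].
  - by case: (_ \in Ts) => // _; evs.
  - case: (_ \in Ts) => // _; evs.
    eapply ev_call; first by evs.
    by apply: (@call_tree B0 k (k + k).+1 A [::] [:: v; n + v] [::] m) => //=; nlia.
fin.
Qed.

(** * Total cost *)

Lemma enclE (A : Type) (f : A -> data) s : enc_seq (map f s) = encl f s.
Proof. by rewrite /enc_seq /encl foldr_map. Qed.

Lemma enc_setE n (A : {set 'I_n}) : enc_set A = nats (vals A).
Proof. by rewrite /enc_set /vals -enclE -map_comp. Qed.

Lemma enc_inputE (G : digraph) (T : {set vertex G}) k :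
  enc_input T k = VPair (VNat (nb_vertices G)) (VPair (sets (adjacency G))
    (VPair (nats (vals (undeletable G))) (VPair (nats (vals T)) (VNat k)))).
Proof.
rewrite /enc_input !enc_setE; congr (VPair _ (VPair _ _)).
rewrite /adjacency -enclE -map_comp; congr enc_seq.
by apply: eq_map => u; rewrite /= enc_setE.
Qed.

Lemma size_vals n (A : {set 'I_n}) : size (vals A) <= n.
Proof. by rewrite size_map -cardE -[X in _ <= X]card_ord max_card. Qed.

Definition Tmain m Q := 8 * Tcount m + 3 * Tsimple m + loop_cost m 30 + Tnetwork m +
  Tseps m + Tfamily m + Ttuples m Q + Toutput m Q + 500.

Section Main.
Variables (G : digraph) (T : {set vertex G}) (k m : nat).
Notation n := (nb_vertices G).
Let net := network (down k.+1) (vals (undeletable G)) n (adjacency G).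
Let q := 2 ^ (4 * k + 3).

Hypothesis n_le : n <= m.
Hypothesis q_le : q <= m.
Hypothesis net_le : size net + (n + size net * size net) <= m.
Hypothesis family_le : 2 ^ (4 * k + 2) * size (log_list n n 1) <= m.

Lemma exponent_lt : 4 * k + 3 < m.
Proof. by apply: leq_trans q_le; apply: ltn_expl. Qed.

Lemma small_separator_lists :
  small_seps m (separator_lists (targets_init (vals T)) k n net (vals T) (iota 0 n)).
Proof.
have km := exponent_lt; rewrite separator_listsE; split.
  rewrite size_rev size_map size_filter.
  by apply: leq_trans (count_size _ _) _; rewrite size_iota.
move=> vL; rewrite mem_rev => /mapP[v _ ->]; split.
  have := size_tree (targets_init (vals T)) k (k + k).+1 net [::] [:: v; n + v] [::].
  rewrite addn0 => /leq_trans; apply.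
  by apply: leq_trans q_le; rewrite leq_exp2l //; lia.
move=> D /size_tree_mem[//|le]; apply: leq_trans le _.
by rewrite /=; nlia.
Qed.

Lemma call_main :
  call prog 0 (enc_input T k) (sets (output T k)) (Tmain m (q ^ k)).
Proof.
have km := exponent_lt; rewrite enc_inputE /call /=.
have leT : size (vals T) <= m by apply: leq_trans (size_vals _) n_le.
have leU : size (vals (undeletable G)) <= m by apply: leq_trans (size_vals _) n_le.
have Hvs := call_down n_le.
have k4 : 4 * k + 3 <= m by apply: ltnW.
have Hq := call_pow2 k4; have Hcol := call_down q_le.
have k42 : 4 * k + 2 <= m by nlia.
have r_le : 2 ^ (4 * k + 2) <= m.
  by apply: leq_trans q_le; rewrite leq_exp2l //; lia.
have Hr := call_pow2 k42; have Hrs := call_down r_le.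
have k1 : k.+1 <= m by nlia.
have Hcnt := call_down k1.
have k0 : k <= m by nlia.
have Hk := call_down k0.
have Hinit := call_init leT.
have szB0 : size (targets_init (vals T)) <= n.
  by rewrite targets_initE size_map size_rev size_vals.
have [||||v Hnet] := @call_network (down k.+1) (vals (undeletable G)) n (adjacency G) m.
- by rewrite size_down.
- by [].
- by rewrite size_map size_enum_ord.
- by move=> row /mapP[u _ ->]; apply: leq_trans (size_vals _) n_le.
have Hrev : call prog f_rev (VPair (VNat 0) (VPair (nats (down n)) (VNat 0)))
    (nats (iota 0 n)) (Tsimple m).
  by rewrite -[iota 0 n]revK; apply: call_rev; rewrite size_down.
have Hseps : call prog f_seps
    (VPair (VPair (nats (vals T)) (VPair (VPair (entries (targets_init (vals T))) (VNat k))
       (VPair (VNat (k + k).+1) (VPair (VNat n) (darcs net))))) (VPair (nats (iota 0 n)) (VNat 0)))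
    (encl enc_sep (separator_lists (targets_init (vals T)) k n net (vals T) (iota 0 n)))
    (Tseps m).
  apply: call_seps => //.
  - by move=> e; apply: targets_init_nil.
  - by rewrite size_iota.
  - by nlia.
  - by apply: leq_trans net_le; rewrite leq_add2l leq_add2r.
  - by apply: leq_trans q_le; rewrite leq_exp2l //; lia.
have Hlog : call prog f_log (VPair (VNat n) (VNat 1)) (nats (log_list n n 1)) (loop_cost m 30).
  by apply: call_log => //; lia.
have Hfam := @call_family (down q) (down n) (log_list n n 1) (down (2 ^ (4 * k + 2))) m.
rewrite !size_down in Hfam; have {}Hfam := Hfam family_le r_le n_le q_le.
have q0 : 0 < q by rewrite expn_gt0.
have Htup := @call_tuples (down q) k m.
rewrite size_down in Htup; have {}Htup := Htup q0 q_le k0.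
have Hout : call prog f_output
    (VPair (VPair (encl enc_sep
       (separator_lists (targets_init (vals T)) k n net (vals T) (iota 0 n)))
                  (sets (tuples (down q) k)))
       (VPair (hashes (hash_family (down q) (down n) (log_list n n 1) (down (2 ^ (4 * k + 2)))))
          (VPair (VNat 0) (VNat 0))))
    (sets (output T k)) (Toutput m (q ^ k)).
  apply: call_output; last exact: small_separator_lists.
  - rewrite hash_familyE size_down; apply: leq_trans family_le.
    by elim: (_ * _) => //= L IH; rewrite ltnS.
  - move=> h; rewrite hash_familyE => /mem_iter_hash[H' ->].
    by rewrite size_new_hash size_down.
  - by move=> t /size_mem_tuples ->.
  - by rewrite size_tuples size_down.
have e4 c : k + k + (k + k) + c = 4 * k + c by lia.
apply: ev_weaken.
  eapply ev_let; first by eapply ev_call; [evs | exact: Hvs].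
  eapply ev_let.
    eapply ev_call; last exact: Hcol.
    by eapply ev_call; [|exact: Hq]; evs; rewrite e4.
  eapply ev_let; first by eapply ev_call; [evs | exact: Hinit].
  eapply ev_let.
    eapply ev_snd; eapply ev_call; last exact: Hnet.
    by evs; eapply ev_call; [|exact: Hcnt]; evs; rewrite addn1.
  eapply ev_let.
    eapply ev_call; last exact: Hseps.
    evs; first by rewrite addn1.
    by eapply ev_call; [evs | exact: Hrev].
  eapply ev_let.
    eapply ev_call; last exact: Hfam.
    evs; first by eapply ev_call; [evs | exact: Hlog].
    eapply ev_call; last exact: Hrs.
    by eapply ev_call; [|exact: Hr]; evs; rewrite e4.
  eapply ev_call; last exact: Hout.
  by evs; eapply ev_call; [evs; eapply ev_call; [evs | exact: Hk] | exact: Htup].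
by rewrite /Tmain; fin.
Qed.

End Main.

(** * Polynomial bounds on the costs *)

Definition poly_bounded (f : nat -> nat) :=
  exists c d, forall m, 0 < m -> f m <= c * m ^ d.

Lemma poly_const c : poly_bounded (fun _ => c).
Proof. by exists c, 0 => m _; rewrite muln1. Qed.

Lemma poly_id : poly_bounded (fun m => m).
Proof. by exists 1, 1 => m _; rewrite mul1n. Qed.

Lemma poly_add f g : poly_bounded f -> poly_bounded g ->
  poly_bounded (fun m => f m + g m).
Proof.
move=> [c [d H]] [c' [d' H']]; exists (c + c'), (maxn d d') => m m0.
rewrite mulnDl; apply: leq_add.
  by apply: leq_trans (H m m0) _; rewrite leq_mul2l leq_pexp2l ?leq_maxl ?orbT.
by apply: leq_trans (H' m m0) _; rewrite leq_mul2l leq_pexp2l ?leq_maxr ?orbT.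
Qed.

Lemma poly_mul f g : poly_bounded f -> poly_bounded g ->
  poly_bounded (fun m => f m * g m).
Proof.
move=> [c [d H]] [c' [d' H']]; exists (c * c'), (d + d') => m m0.
by rewrite expnD mulnACA leq_mul ?H ?H'.
Qed.

Lemma poly_loop f : poly_bounded f -> poly_bounded (fun m => loop_cost m (f m)).
Proof.
move=> Hf; apply: poly_add (poly_const _).
exact: poly_mul poly_id (poly_add Hf (poly_const _)).
Qed.

Ltac poly :=
  repeat first [ assumption | apply: poly_const | apply: poly_id | apply: poly_loop
               | apply: poly_add | apply: poly_mul ].

(** The number [Q] of tuples enters linearly: the two nested loops over tuples are at most [Q] times
    a loop without them, and all other terms may be multiplied by [Q] because it is positive. *)
Lemma poly_Tmain : exists c d, forall m Q, 0 < m -> 0 < Q ->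
  Tmain m Q <= Q * (c * m ^ d).
Proof.
pose F m := 8 * Tcount m + 3 * Tsimple m + loop_cost m 30 + Tnetwork m + Tseps m +
  Tfamily m + loop_cost m (Tsimple m + 200) + loop_cost m (Tshadow m + 200) + 500.
have H1 : poly_bounded Tsimple by apply: poly_loop; poly.
have H2 : poly_bounded Trelax by apply: poly_loop; poly.
have H3 : poly_bounded Tbfs by apply: poly_loop; poly.
have H4 : poly_bounded Tflow.
  by apply: poly_mul; poly; apply: poly_loop; poly.
have H5 : poly_bounded Ttree by apply: poly_mul; poly.
have H6 : poly_bounded Trow by apply: poly_loop; poly.
have H7 : poly_bounded Tcolor by apply: poly_add; poly.
have H8 : poly_bounded Tweight by apply: poly_loop; poly.
have H9 : poly_bounded Tcost by apply: poly_loop; poly.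
have H10 : poly_bounded Tbest by apply: poly_loop; poly.
have H11 : poly_bounded Thash by apply: poly_loop; poly.
have H12 : poly_bounded Tgrow by apply: poly_loop; poly.
have H13 : poly_bounded Tfamily by apply: poly_loop; poly.
have H14 : poly_bounded Tall by apply: poly_loop; poly.
have H15 : poly_bounded Tsome by apply: poly_loop; poly.
have H16 : poly_bounded Tshadow by apply: poly_loop; poly.
have H17 : poly_bounded Tnetwork by apply: poly_loop; poly.
have H18 : poly_bounded Tseps by apply: poly_loop; poly.
have H19 : poly_bounded Tcount by apply: poly_add; poly.
have [c [d H]] : poly_bounded F by rewrite /F; poly.
exists c, d => m Q m0 Q0; apply: leq_trans (_ : Q * F m <= _); last first.
  by rewrite leq_mul2l H ?orbT.
have L x : loop_cost m (loop_cost Q (x + 60) + 60) <= Q * loop_cost m (x + 200).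
  by rewrite /loop_cost; nia.
have le x : x <= Q * x by rewrite leq_pmull.
rewrite /Tmain /F; do 8!rewrite (mulnDr Q).
do 8!(apply: leq_add; last by first [exact: le | exact: L]).
exact: le.
Qed.

Lemma data_size_encl (A : Type) (f : A -> data) s : size s <= data_size (encl f s).
Proof. by elim: s => //= x s IH; lia. Qed.

Lemma input_size_gt0 (G : digraph) (T : {set vertex G}) k : 0 < data_size (enc_input T k).
Proof. by []. Qed.

(** The number of vertices itself is measured in binary, but the adjacency list has one row per
    vertex. *)
Lemma vertices_le_input (G : digraph) (T : {set vertex G}) k :
  nb_vertices G <= data_size (enc_input T k).
Proof.
rewrite enc_inputE /=; have := data_size_encl (encl VNat) (adjacency G).
by rewrite size_map size_enum_ord; lia.
Qed.

Lemma size_log_list fuel n p : size (log_list fuel n p) <= 2 * fuel + 1.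
Proof. by elim: fuel p => //= f IH p; case: ifP => _ //=; have := IH (p + p); lia. Qed.

(** * Choice of a common bound on list lengths *)

Section Budget.
Variables (G : digraph) (k N : nat).
Notation n := (nb_vertices G).
Hypothesis N_gt0 : 0 < N.
Hypothesis n_le_N : n <= N.

(** The common bound is [x ^ 5]: the network has at most [x ^ 2] arcs, a search may store the square
    of that many entries, and the sum to be bounded is at most [3 * x ^ 4]. The exponent [4 * k + 5]
    is [4 * k + 2] for the hashing rounds plus 3 for their length, at most [2 * n + 1 <= 8 * N]. *)
Let x := 2 ^ (4 * k + 5) * N.

Lemma budget_x : 3 <= x /\ x <= x ^ 5.
Proof.
have x3 : 3 <= x.
  apply: (@leq_trans (2 ^ 5)) => //; apply: leq_trans (leq_pmulr _ N_gt0).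
  by rewrite leq_exp2l // leq_addl.
by split=> //; rewrite -{1}[x]expn1 leq_pexp2l //; lia.
Qed.

Lemma budget_n : n <= x ^ 5.
Proof.
apply: leq_trans (proj2 budget_x); apply: leq_trans n_le_N _.
by rewrite leq_pmull // expn_gt0.
Qed.

Lemma budget_q : 2 ^ (4 * k + 3) <= x ^ 5.
Proof.
apply: leq_trans (proj2 budget_x).
apply: leq_trans (_ : 2 ^ (4 * k + 5) <= _); last by rewrite leq_pmulr.
by rewrite leq_exp2l //; lia.
Qed.

Lemma budget_family : 2 ^ (4 * k + 2) * size (log_list n n 1) <= x ^ 5.
Proof.
apply: leq_trans (proj2 budget_x).
have -> : x = 2 ^ (4 * k + 2) * (2 ^ 3 * N) by rewrite mulnA -expnD -addnA.
rewrite leq_mul2l; apply/orP; right.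
by apply: leq_trans (size_log_list _ _ _) _; lia.
Qed.

Let s := size (network (down k.+1) (vals (undeletable G)) n (adjacency G)).

Lemma budget_net : s + (n + s * s) <= x ^ 5.
Proof.
have [x3 _] := budget_x.
have sx : s <= x ^ 2.
  apply: leq_trans (size_net G k) _.
  have kx : 2 * k.+1 <= 2 ^ (4 * k + 5).
    rewrite expnD; have := ltn_expl (4 * k) (isT : 1 < 2); lia.
  apply: leq_trans (_ : k.+1 * (2 * (N * N)) <= _).
    by rewrite leq_mul2l; apply/orP; right; nia.
  have -> : x ^ 2 = 2 ^ (4 * k + 5) * 2 ^ (4 * k + 5) * (N * N).
    by rewrite -mulnn mulnACA.
  rewrite mulnA; apply: leq_mul => //; rewrite mulnC; apply: leq_trans kx _.
  by rewrite leq_pmulr // expn_gt0.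
have nx : n <= x by apply: leq_trans n_le_N _; rewrite leq_pmull // expn_gt0.
have ssx : s * s <= x ^ 4 by rewrite (expnD x 2 2) leq_mul.
apply: leq_trans (leq_add sx (leq_add nx ssx)) _.
apply: leq_trans (_ : 3 * x ^ 4 <= _); last by rewrite [in leqRHS]expnS leq_mul2r x3 orbT.
have : x ^ 2 <= x ^ 4 by rewrite leq_pexp2l //; lia.
have : x <= x ^ 4 by rewrite -{1}[x]expn1 leq_pexp2l //; lia.
by lia.
Qed.

End Budget.

Theorem theorem7 :
  exists (P : program) (f g : nat -> nat) (c d : nat),
    bigO f (fun k => k ^ 2) /\ bigO g (fun k => k ^ 2) /\
    forall (G : digraph) (T : {set vertex G}) (k : nat),
    exists (t : nat) (Z : t.-tuple {set vertex G}) (time : nat),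
      [/\ runs P (enc_input T k) (enc_output Z) time,
          time <= 2 ^ f k * (c * data_size (enc_input T k) ^ d),
          t <= 2 ^ g k * log2 (nb_vertices G),
          (forall i : 'I_t, tnth Z i \subset ~: T)
        & forall W Y : {set vertex G},
            W \subset ~: (T :|: undeletable G) ->
            thin T W ->
            #|W| <= k ->
            (forall v, v \in Y ->
               exists W' : {set vertex G},
                 W' \subset W /\ important_separator [set v] T W') ->
            exists i : 'I_t, W :&: tnth Z i = set0 /\ Y \subset tnth Z i].
Proof.
have [c [d costP]] := poly_Tmain.
(* The first summand is the exponent of [q ^ k], the number of tuples; the second comes from [m ^ d]
   with [m = x ^ 5]. *)
exists prog, (fun k => (4 * k + 3) * k + (4 * k + 5) * (5 * d)).
exists (fun k => 4 * k ^ 2 + 7 * k + 5), c, (5 * d); split; last split.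
(* From [k = 1] on, all lower terms are charged to [k ^ 2]: 4 + 3 = 7 and 5 * (4 + 5) = 45 here, 4 +
   7 + 5 = 16 for the number of sets. *)
- by exists (7 + 45 * d), 1 => k k1; rewrite -mulnn; nia.
- by exists 16, 1 => k k1; rewrite -mulnn; nia.
move=> G T k; set N := data_size _.
have N0 : 0 < N := input_size_gt0 T k.
have nN : nb_vertices G <= N := vertices_le_input T k.
pose x := 2 ^ (4 * k + 5) * N.
have [time le_time run] := call_main T (budget_n k N0 nN) (budget_q k N0 nN)
  (budget_net k N0 nN) (budget_family k N0 nN).
pose Zs := [seq vset G z | z <- output T k].
exists (size Zs), (in_tuple Zs), time; split.
- suff -> : enc_output (in_tuple Zs) = sets (output T k) by [].
  rewrite /enc_output /= /Zs -map_comp -enclE; congr enc_seq.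
  apply/eq_in_map => z /output_sets[zE _] /=.
  by rewrite enc_setE -zE.
- apply: leq_trans le_time _.
  have x0 : 0 < x ^ 5 by rewrite expn_gt0 muln_gt0 expn_gt0 N0.
  have Q0 : 0 < (2 ^ (4 * k + 3)) ^ k by rewrite !expn_gt0.
  apply: leq_trans (costP _ _ x0 Q0) _.
  rewrite -expnM expnD -mulnA leq_mul2l; apply/orP; right.
  by rewrite /x -expnM expnMn -expnM mulnCA.
- by rewrite size_map; apply: size_output.
- move=> i; rewrite (tnth_nth set0) /=.
  have /mapP[z /output_sets[_ sub] ->] : nth set0 Zs i \in Zs by apply: mem_nth.
  exact: sub.
move=> W Y subW thinW cardW impY.
have [z zO [WZ YZ]] := output_cover subW thinW cardW impY.
have zZ : vset G z \in Zs by apply: map_f.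
have lt : index (vset G z) Zs < size Zs by rewrite index_mem.
by exists (Ordinal lt); rewrite (tnth_nth set0) /= nth_index.
Qed.
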